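(* Let $n\geq1$ and $r\geq2$ be integers, let $k_1,\ldots,k_r$ be integers with $0\leq k_i\leq(r-1)n/r$ for every $i\in[r]$, and let $\mathcal F_i\subseteq\binom{[n]}{k_i}$ ($i\in[r]$) be $r$-cross-intersecting. Then $$\prod_{i=1}^r\mu_{k_i}(\mathcal F_i)\leq\prod_{i=1}^r\frac{k_i}{n}.$$ The equality cases are as follows. (a) If $k_i=0$ for some $i\in[r]$, equality holds for all such families. (b) Suppose that $k_i>0$ for every $i\in[r]$, and either $r\geq3$, or $r=2$ and $k_1+k_2<n$. Then equality holds if and only if the families are full $1$-stars with a common center, i.e. there is $x\in[n]$ with $\mathcal F_i=\{A\in\binom{[n]}{k_i}:x\in A\}$ for every $i\in[r]$. (c) If $r=2$ and $k_1+k_2=n$, then $k_1=k_2=\frac n2$, and equality holds if and only if there exists $\mathcal F\subseteq\binom{[n]}{n/2}$ with $|\mathcal F|=\frac12\binom{n}{n/2}$ such that $$\mathcal F_1=\mathcal F\quad\text{and}\quad\mathcal F_2=\left\{B\in\binom{[n]}{n/2}:[n]\setminus B\notin\mathcal F\right\}.$$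
   Context: $[n]=\{1,\ldots,n\}$ and $\binom{[n]}k$ is the collection of all $k$-element subsets of $[n]$. For $\mathcal F\subseteq\binom{[n]}k$, $\mu_k(\mathcal F)=|\mathcal F|/\binom nk$. Families $\mathcal F_1,\ldots,\mathcal F_r$ of subsets of $[n]$ are $r$-cross-intersecting if $A_1\cap\cdots\cap A_r\neq\varnothing$ whenever $A_i\in\mathcal F_i$ for every $i\in[r]$. *)

(* Defs.v *)
From mathcomp Require Import all_boot all_order all_algebra.

Set Implicit Arguments.
Unset Strict Implicit.
Unset Printing Implicit Defensive.

Import Order.TTheory GRing.Theory Num.Theory.

Local Open Scope ring_scope.

(* The ground set [n] = {1, ..., n} is represented by 'I_n = {0, ..., n - 1}. *)

Definition ksubsets (n k : nat) : {set {set 'I_n}} :=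
  [set A : {set 'I_n} | #|A| == k].

Definition mu (n k : nat) (F : {set {set 'I_n}}) : rat :=
  #|F|%:R / 'C(n, k)%:R.

Definition cross_intersecting (n r : nat) (F : 'I_r -> {set {set 'I_n}}) : Prop :=
  forall A : 'I_r -> {set 'I_n},
    (forall i, A i \in F i) -> \bigcap_(i < r) A i != set0.

Definition full_star (n k : nat) (x : 'I_n) : {set {set 'I_n}} :=
  [set A in ksubsets n k | x \in A].

(* The first two members of a list of length r >= 2: the indices written 1 and
   2 in the mathematics are the ordinals of values 0 and 1. *)
Definition idx1 (r : nat) (hr : (2 <= r)%N) : 'I_r := Ordinal (ltnW hr).
Definition idx2 (r : nat) (hr : (2 <= r)%N) : 'I_r := Ordinal hr.

(* Main.v *)
Require Import Defs.
From mathcomp Require Import all_boot all_order all_algebra fingroup perm.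
From mathcomp Require Import zify ring lra.

(** Pass to the complements: the families G_i of m_i-sets, m_i = n - k_i >= n/r,
    contain no r sets covering [n].  If the integers d_i <= m_i sum to n, a
    random partition of [n] into blocks of sizes d_i shows that the densities
    y_i(d_i) of the lower shadows of the G_i at the levels d_i satisfy
    sum_i y_i(d_i) <= r - 1, and by Kruskal-Katona y_i(d) is at least the
    density of the shadow of a colexicographic initial segment of size #|G_i|.
    Write mu_i = c_i k_i/n.  A family with c_i > 1 contains (up to
    compression) a star, one with c_i <= 1 is contained in one.  Taking
    d_i = m_i for the former and distributing the remaining
    n - sum m_i among the latter, the excess of the former is bounded by the
    deficiency of the latter, which yields prod_i c_i <= 1, strictly unless every
    c_i is 1.

    When every c_i is 1 all the inequalities above are equalities.
    For r = 2 and k_1 + k_2 < n the shadow of G_i one level below has the size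
    of the shadow of a complete family on n - 1 points, so G_i is such a family.
    For r >= 3 the sets of size d_i that are not in the shadow of G_i form
    pairwise cross-intersecting families of the size of a star, and the case of
    two families applies to them. *)

Set Implicit Arguments.
Unset Strict Implicit.
Unset Printing Implicit Defensive.

Import Order.TTheory GRing.Theory Num.Theory.

(** * Shadows and compression *)

Local Open Scope nat_scope.

(** The sets complementary to a star have shadow density 1 - d/n at level d, and for levels summing
    to n these add up to exactly r - 1. Only deviations from stars matter, hence the normalisation
    by c_i. The loss of a deficient family is measured in two ways. The measure 1/c - 1 comes with
    the coefficient d (r - 1), which vanishes with d. If i is the only excess, the other r - 1
    families share n - m_i = k_i, so averaging gives c_i - 1 at most the sum of the 1/c_j - 1, and
    the product of the 1/c_j is at least one plus that sum. Several excesses multiply, and such a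
    comparison of sums no longer controls their product. A measure additive over factors, like minus
    a logarithm, takes over. Its coefficient d (r - 2) + n/r does not vanish at d = 0; it is
    affordable because k_i then includes m_j for another excess j. *)

Section Shadow.
Variable T : finType.
Implicit Types (A B X : {set T}) (G H : {set {set T}}) (x y : T).

Definition uniform_on X m : {set {set T}} := [set A : {set T} | (A \subset X) && (#|A| == m)].

Definition shadow G : {set {set T}} := [set B : {set T} | [exists y, (y \notin B) && (y |: B \in G)]].

Lemma shadowP G B : reflect (exists2 y, y \notin B & y |: B \in G) (B \in shadow G).
Proof.
rewrite inE; apply: (iffP existsP) => [[y /andP[]]|[y yB GB]]; first by exists y.
by exists y; rewrite yB.
Qed.

Lemma shadow_uniform X m G :
  G \subset uniform_on X m.+1 -> shadow G \subset uniform_on X m.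
Proof.
move=> /subsetP sG; apply/subsetP => B /shadowP[y yB /sG].
rewrite !inE cardsU1 yB subUset eqSS => /andP[/andP[_ ->] ->] //.
Qed.

Definition swap x y A : {set T} := [set tperm x y z | z in A].

Lemma in_swap x y A z : (z \in swap x y A) = (tperm x y z \in A).
Proof.
by rewrite -{1}(tpermK x y z) mem_imset //; apply: perm_inj.
Qed.

Lemma swapK x y : involutive (swap x y).
Proof. by move=> A; apply/setP => z; rewrite !in_swap tpermK. Qed.

Lemma swapU1 x y z A : swap x y (z |: A) = tperm x y z |: swap x y A.
Proof. by rewrite /swap imsetU1. Qed.

Lemma card_swap x y A : #|swap x y A| = #|A|.
Proof. by rewrite card_imset //; apply: perm_inj. Qed.

Lemma swap_id x y A : (x \in A) = (y \in A) -> swap x y A = A.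
Proof.
move=> xy; apply/setP => z; rewrite in_swap.
by case: tpermP => [->|->|].
Qed.

(* The sets that the compression replacing y by x may remove from a family. *)
Definition movable x y A := (y \in A) && (x \notin A).

(** Phrased by orbits of the transposition: an orbit contained in the family stays whole, and an
    orbit of two sets with one in the family keeps the one that is not [movable]. *)
Definition compress x y G : {set {set T}} :=
  [set A | ((A \in G) || (swap x y A \in G)) &&
           (movable x y A ==> (A \in G) && (swap x y A \in G))].

Lemma movable_swap x y A : swap x y A != A -> ~~ movable x y A -> movable x y (swap x y A).
Proof.
move=> sA; rewrite /movable !in_swap tpermL tpermR.
have : (x \in A) != (y \in A) by apply: contraNneq sA => /swap_id->.
by case: (x \in A); case: (y \in A).
Qed.

(** Two injections, each sending a set to itself or to its image under [swap], bound either size by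
    the other. *)
Lemma card_compress x y G : #|compress x y G| = #|G|.
Proof.
apply/eqP; rewrite eqn_leq; apply/andP; split.
  pose f A := if A \in G then A else swap x y A.
  rewrite -(@card_in_imset _ _ f (compress x y G)); last first.
    have key A B : A \in compress x y G -> B \in compress x y G ->
        A \in G -> B \notin G -> A = swap x y B -> A = B.
      move=> cA cB GA nGB eAB.
      have [sB|sB] := eqVneq (swap x y B) B; first by rewrite eAB.
      have oB : ~~ movable x y B.
        by apply: contraNN nGB => oB; move: cB; rewrite inE oB => /andP[_ /andP[]].
      have oA := movable_swap sB oB; rewrite -eAB in oA.
      by move: cA; rewrite inE oA eAB swapK (negPf nGB) andbF andbF.
    move=> A B cA cB; rewrite /f.
    case: ifPn => GA; case: ifPn => GB //.
    - exact: key.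
    - by move=> /esym /key-> .
    - by move/(inv_inj (swapK x y)).
  apply/subset_leq_card/subsetP => _ /imsetP[A cA ->]; rewrite /f.
  by case: ifPn => // nGA; move: cA; rewrite inE (negPf nGA) => /andP[].
pose f A := if A \in compress x y G then A else swap x y A.
have mov A : A \in G -> A \notin compress x y G -> movable x y A /\ swap x y A \notin G.
  by rewrite inE => ->/=; rewrite negb_imply => /andP[].
rewrite -(@card_in_imset _ _ f G); last first.
  have key A B : A \in G -> B \in G -> B \notin compress x y G -> A = swap x y B -> A = B.
    by move=> GA GB /(mov _ GB)[_ /negPf nG] eAB; rewrite -eAB GA in nG.
  move=> A B GA GB; rewrite /f; case: ifPn => cA; case: ifPn => cB //.
  - exact: key.
  - by move=> /esym /key ->.
  - by move/(inv_inj (swapK x y)).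
apply/subset_leq_card/subsetP => _ /imsetP[A GA ->]; rewrite /f.
case: ifPn => // /(mov _ GA)[/andP[yA xA] _].
by rewrite inE swapK GA orbT /= /movable !in_swap tpermL tpermR (negPf xA).
Qed.

Lemma shadow_swapP x y G B z : z \notin B -> swap x y (z |: B) \in G -> swap x y B \in shadow G.
Proof.
move=> zB; rewrite swapU1 => GB; apply/shadowP; exists (tperm x y z) => //.
by rewrite in_swap tpermK.
Qed.

Lemma shadow_compress x y G : shadow (compress x y G) \subset compress x y (shadow G).
Proof.
apply/subsetP => B /shadowP[z zB]; rewrite inE => /andP[GB oB].
rewrite inE; apply/andP; split.
  case/orP: GB => GB; first by apply/orP; left; apply/shadowP; exists z.
  by apply/orP; right; apply: shadow_swapP zB GB.
apply/implyP => /andP[yB xB].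
(* Only for z = x does [z |: B] fail to be movable; it then contains both x and y and is fixed by
   the swap. *)
have [zx|zx] := eqVneq z x; last first.
  have oz : movable x y (z |: B) by rewrite /movable !inE yB orbT negb_or eq_sym zx.
  move: oB; rewrite oz => /andP[GB1 GB2]; apply/andP; split.
    by apply/shadowP; exists z.
  exact: shadow_swapP zB GB2.
subst z; have sB : swap x y (x |: B) = x |: B by rewrite swap_id // !inE eqxx yB orbT.
move: GB; rewrite sB orbb => GB; apply/andP; split; first by apply/shadowP; exists x.
by apply: shadow_swapP zB _; rewrite sB.
Qed.

Lemma swap_uniform X m x y A :
  x \in X -> y \in X -> A \in uniform_on X m -> swap x y A \in uniform_on X m.
Proof.
move=> xX yX; rewrite !inE card_swap => /andP[/subsetP sA ->]; rewrite andbT.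
apply/subsetP => z; rewrite in_swap => /sA; case: tpermP => [->|->|] //.
Qed.

Lemma compress_uniform X m x y G :
  x \in X -> y \in X -> G \subset uniform_on X m -> compress x y G \subset uniform_on X m.
Proof.
move=> xX yX /subsetP sG; apply/subsetP => A; rewrite inE => /andP[/orP[/sG //|/sG sA] _].
by rewrite -(swapK x y A); apply: swap_uniform.
Qed.

Lemma exists_compressed X m x G : x \in X -> G \subset uniform_on X m ->
  exists H : {set {set T}}, [/\ H \subset uniform_on X m, #|H| = #|G|, #|shadow H| <= #|shadow G|
    & forall A y, A \in H -> y \in A -> x \notin A -> x |: (A :\ y) \in H].
Proof.
move=> xX sG.
pose P (H : {set {set T}}) :=
  [&& H \subset uniform_on X m, #|H| == #|G| & #|shadow H| <= #|shadow G|].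
have PG : P G by rewrite /P sG eqxx leqnn.
(* An extremal choice replaces iterated compression: a family with the most sets through x is
   closed, since a compression that moves a set raises this number. *)
pose f (H : {set {set T}}) := #|[set A in H | x \in A]|.
have [H /and3P[sH /eqP cH shH] maxH] := arg_maxnP f PG.
exists H; split=> // A y HA yA xA.
have yX : y \in X by move/subsetP: sH => /(_ A HA); rewrite inE => /andP[/subsetP ->].
have -> : x |: (A :\ y) = swap x y A.
  apply/setP => z; rewrite in_swap !inE; case: tpermP => [->|->|/eqP zx /eqP zy].
  - by rewrite eqxx yA.
  - rewrite eqxx (negPf xA) /= orbF; by apply: contraNF xA => /eqP <-.
  - by rewrite (negPf zx) zy.
apply/negP => /negP nH.
have := maxH (compress x y H); rewrite /P compress_uniform //= card_compress cH eqxx /=.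
rewrite (leq_trans (subset_leq_card (shadow_compress _ _ _))) ?card_compress // => /(_ isT).
apply/negP; rewrite -ltnNge; apply: proper_card; apply/properP; split.
  apply/subsetP => B; rewrite !inE => /andP[-> xB]; rewrite xB /= andbT.
  by rewrite /movable xB andbF.
exists (swap x y A); last by rewrite !inE (negPf nH).
by rewrite !inE swapK HA orbT /movable !in_swap tpermL tpermR yA (negPf xA).
Qed.

(** * Links of a point and sets avoiding it *)

Definition link x G : {set {set T}} := [set A : {set T} | (x \notin A) && (x |: A \in G)].
Definition avoid x G : {set {set T}} := [set A in G | x \notin A].

Lemma card_link x G : #|link x G| = #|[set A in G | x \in A]|.
Proof.
rewrite -(@card_in_imset _ _ (fun A => x |: A) (link x G)); last first.
  move=> A B; rewrite !inE => /andP[xA _] /andP[xB _] eAB.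
  by rewrite -(setU1K xA) -(setU1K xB) eAB.
apply: eq_card => A; rewrite !inE; apply/imsetP/andP.
  by case=> B; rewrite inE => /andP[xB GB] ->; rewrite GB setU11.
case=> GA xA; exists (A :\ x); last by rewrite setD1K.
by rewrite !inE eqxx setD1K.
Qed.

Lemma card_link_avoid x G : #|link x G| + #|avoid x G| = #|G|.
Proof.
rewrite card_link -(cardsID [set A : {set T} | x \in A] G).
by congr (_ + _); apply: eq_card => A; rewrite !inE // andbC.
Qed.

Lemma link_uniform X m x G : G \subset uniform_on X m.+1 -> link x G \subset uniform_on (X :\ x) m.
Proof.
move=> /subsetP sG; apply/subsetP => A; rewrite inE => /andP[xA /sG].
by rewrite !inE cardsU1 xA subUset eqSS subsetD1 xA => /andP[/andP[_ ->] ->].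
Qed.

Lemma avoid_uniform X m x G : G \subset uniform_on X m -> avoid x G \subset uniform_on (X :\ x) m.
Proof.
move=> /subsetP sG; apply/subsetP => A; rewrite inE => /andP[/sG].
by rewrite !inE subsetD1 => /andP[-> ->] ->.
Qed.

Lemma shadow_link x G : shadow (link x G) \subset link x (shadow G).
Proof.
apply/subsetP => B /shadowP[y yB]; rewrite !inE !negb_or => /andP[/andP[xy xB] GB].
rewrite xB /=; apply/existsP; exists y; rewrite !inE negb_or eq_sym xy yB /=.
by rewrite setUCA.
Qed.

Lemma link_sub_shadow x G : link x G \subset avoid x (shadow G).
Proof.
apply/subsetP => B; rewrite !inE => /andP[xB GB]; rewrite xB andbT.
by apply/existsP; exists x; rewrite xB.
Qed.

Lemma card_uniform_on X m : #|uniform_on X m| = 'C(#|X|, m).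
Proof. by rewrite -cards_draws; apply: eq_card => A; rewrite !inE. Qed.

End Shadow.

(** * The Kruskal-Katona theorem *)

(* A word encodes a colexicographic initial segment of the m-subsets of an
   N-point set by reading the points from the last one down: [Wand u] consists
   of sets avoiding the last point, forming the segment [u]; [Wor u] consists of
   all sets avoiding it, together with those containing it whose traces form
   the segment [u].  The same word read at a lower level m encodes the shadow. *)
Inductive word := Wnone | Wall | Wand of word | Wor of word.

Fixpoint wcard (w : word) (N m : nat) : nat :=
  match w with
  | Wnone => 0
  | Wall => 'C(N, m)
  | Wand u => wcard u N.-1 m
  | Wor u => 'C(N.-1, m) + (if m is m'.+1 then wcard u N.-1 m' else 0)
  end.

(* For m = N there is only one m-set, so reading further letters is forbidden:
   otherwise the empty segment would have a word with a nonempty shadow. *)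
Fixpoint wvalid (w : word) (N m : nat) : bool :=
  match w with
  | Wnone | Wall => m <= N
  | Wand u => (m < N) && wvalid u N.-1 m
  | Wor u => (m < N) && (if m is m'.+1 then wvalid u N.-1 m' else true)
  end.

Lemma wvalid_leq w N m : wvalid w N m -> m <= N.
Proof. by case: w => [|||] //= u /andP[/ltnW]. Qed.

Lemma wvalidW w N m d : d <= m -> wvalid w N m -> wvalid w N d.
Proof.
elim: w N m d => [|||] /=; try lia.
  by move=> u IH N m d dm /andP[mN /(IH _ _ _ dm) ->]; rewrite (leq_ltn_trans dm).
move=> u IH N [|m] [|d] dm /andP[mN Vu]; rewrite ?(leq_ltn_trans dm mN) //=.
exact: IH Vu.
Qed.

Lemma wvalid_pred w N m : wvalid w N m.+1 -> wvalid w N.-1 m.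
Proof.
elim: w N m => [|||] /=; try lia.
  by move=> u IH N m /andP[mN /IH ->]; lia.
move=> u IH N [|m] /andP[mN Vu]; rewrite ?(leq_ltn_trans dm mN) //=; first by lia.
by rewrite (IH _ _ Vu) andbT; lia.
Qed.

Lemma wcard0_pred w N : wcard w N 0 = wcard w N.-1 0.
Proof.
elim: w N => [|||] //=.
- by move=> N; rewrite !bin0.
- by move=> u _ N; rewrite !bin0.
Qed.

(** The size of a segment is a sum of binomials whose shifts depend on the word alone, so Pascal's
    rule applies term by term; [wvalid] keeps N large enough for it. *)
Lemma wcard_pascal w N m : wvalid w N m.+1 ->
  wcard w N m.+1 = wcard w N.-1 m.+1 + wcard w N.-1 m.
Proof.
elim: w N m => [|||] //=.
- by move=> [|N] m //= _; rewrite binS.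
- by move=> u IH N m /andP[mN /IH].
move=> u IH [|[|N]] m //= /andP[mN Vu].
rewrite binS; case: m mN Vu => [|m] mN Vu; first by rewrite !bin0 (wcard0_pred _ N.+1) /=; lia.
by rewrite (IH _ _ Vu) /=; lia.
Qed.

Lemma wcard_leq w N m : wvalid w N m -> wcard w N m <= 'C(N, m).
Proof.
elim: w N m => [|||] //=.
  by move=> u IH N m /andP[mN /IH /leq_trans->] //; apply: leq_bin2l; lia.
move=> u IH [|N] [|m] // /andP[mN Vu] /=; first by rewrite !bin0.
by rewrite binS leq_add2l IH.
Qed.

(* Replaces a letter read at m = N by [Wall], adding at most one set. *)
Fixpoint wnormal (w : word) (N m : nat) : word :=
  match w with
  | Wnone | Wall => w
  | Wand u => if m < N then Wand (wnormal u N.-1 m) else Wall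
  | Wor u => if m < N then Wor (if m is m'.+1 then wnormal u N.-1 m' else u) else Wall
  end.

Lemma wnormal_valid w N m : m <= N -> wvalid (wnormal w N m) N m.
Proof.
elim: w N m => [|||] //= u IH N m mN; case: ifP => //= mN'; rewrite ?mN' /=.
  by apply: IH; lia.
by case: m mN mN' => // m mN mN'; apply: IH; lia.
Qed.

Lemma wnormal_card w N m : m <= N -> wcard (wnormal w N m) N m <= (wcard w N m).+1.
Proof.
elim: w N m => [|||] //= u IH N m mN; case: ifP => //= mN'.
- by apply: IH; lia.
- by rewrite (_ : m = N) ?binn //; lia.
- by case: m mN mN' => [|m] mN mN' //; have := IH N.-1 m; lia.
- by rewrite (_ : m = N) ?binn //; lia.
Qed.

Lemma wnormal_card_pred w N m : m < N -> wvalid w N m ->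
  wcard w N m <= wcard (wnormal w N m.+1) N m.
Proof.
elim: w N m => [|||] //= u IH N m mN; case: ifP => //= mN' /andP[_ Vu].
- by apply: IH; lia.
- by apply: leq_trans (wcard_leq Vu) _; apply: leq_bin2l; lia.
- by case: m mN mN' Vu => [|m] mN mN' Vu //; have := IH N.-1 m; lia.
- have -> : N = m.+1 by lia.
  case: m mN mN' Vu => [|m] mN mN' Vu; first by rewrite !bin0.
  rewrite binS /= leq_add2l.
  apply: leq_trans (wcard_leq _) (leq_bin2l _ _); last by [].
  by rewrite (_ : m.+1 = N.-1) //; lia.
Qed.

(** Greedy, as for the cascade representation of a: [Wand] while a fits on one point fewer, [Wor]
    otherwise. *)
Lemma wvalid_word_exists N m a : m <= N -> a <= 'C(N, m) ->
  exists2 w, wvalid w N m & wcard w N m = a.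
Proof.
elim: N m a => [|N IH] [|m] a mN aC; rewrite ?bin0 in aC.
- by case: a aC => [|[|]] // _; [exists Wnone|exists Wall].
- by [].
- by case: a aC => [|[|]] // _; [exists Wnone|exists Wall]; rewrite //= bin0.
have [mN' | mN'] := ltnP m N; last first.
  have -> : m = N by lia.
  rewrite (_ : m = N) ?binn in aC; last by lia.
  by case: a aC => [|[|]] // _; [exists Wnone|exists Wall]; rewrite //= binn.
have [aN|aN] := leqP a 'C(N, m.+1).
  by have [u Vu <-] := IH m.+1 a mN' aN; exists (Wand u); rewrite //= Vu andbT.
rewrite binS in aC.
have [||u Vu eu] := IH m (a - 'C(N, m.+1)); [lia|lia|].
by exists (Wor u); rewrite /= ?eu ?Vu; lia.
Qed.

Section KK.
Variable T : finType.
Implicit Types (X : {set T}) (G : {set {set T}}).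

(* Frankl's argument: after compression towards a point x the shadow of the sets
   avoiding x lies in the link of x, so by induction the link cannot be
   smaller than in the initial segment; Pascal's rule concludes. *)
Lemma kruskal_katona_step X m w G : wvalid w #|X| m.+1 -> G \subset uniform_on X m.+1 ->
  wcard w #|X| m.+1 <= #|G| -> wcard w #|X| m <= #|shadow G|.
Proof.
move eqN: #|X| => N.
elim: N X m w G eqN => [|N IH] X m w G cX Vw sG leG.
  by have := wvalid_leq Vw.
have [x xX] : exists x, x \in X by apply/card_gt0P; rewrite cX.
have [H [sH cH shH comp]] := exists_compressed xX sG.
rewrite -cH in leG; apply: leq_trans shH.
have cXx : #|X :\ x| = N by have := cardsD1 x X; rewrite xX cX; lia.
have Hlink : wcard w N m <= #|link x H|.
  rewrite leqNgt; apply/negP => lt_link.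
  have gt_avoid : wcard w N m.+1 < #|avoid x H|.
    rewrite -(ltn_add2l #|link x H|) card_link_avoid (leq_trans _ leG) //.
    by rewrite (wcard_pascal Vw) /= addnC ltn_add2l.
  have sav := avoid_uniform x sH.
  have mN : m < N.
    have := leq_trans gt_avoid (subset_leq_card sav).
    by rewrite card_uniform_on cXx; case: (ltnP m N) => // Nm; rewrite bin_small.
  have Vw' := wvalid_pred Vw; rewrite /= in Vw'.
  have sub : shadow (avoid x H) \subset link x H.
    apply/subsetP => B /shadowP[y yB]; rewrite !inE negb_or => /andP[HyB /andP[xy xB]].
    have := comp _ _ HyB (setU11 _ _); rewrite setU1K // => -> //; first by rewrite xB.
    by rewrite !inE negb_or xy.
  have := subset_leq_card sub; rewrite leqNgt => /negP[]; apply: leq_trans lt_link _.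
  (* At level m.+1 on N points [w] need not be valid. Normalising it costs at most one set, which
     the strict inequality [gt_avoid] supplies, and does not shrink the segment at level m. *)
  apply: leq_trans (wnormal_card_pred mN Vw') _.
  apply: IH cXx (wnormal_valid _ mN) sav _.
  exact: leq_trans (wnormal_card _ mN) _.
clear G sG cH.
rewrite -(card_link_avoid x (shadow H)) addnC.
have sub1 := subset_leq_card (link_sub_shadow x H).
have sub2 := subset_leq_card (shadow_link x H).
case: m Vw sH comp leG Hlink => [|m] Vw sH comp leG Hlink.
  by rewrite wcard0_pred /= (leq_trans Hlink) // (leq_trans sub1) // leq_addr.
rewrite wcard_pascal /=; last exact: wvalidW Vw.
apply: leq_add; first exact: leq_trans Hlink sub1.
exact: leq_trans (IH _ m w _ cXx (wvalid_pred Vw) (link_uniform x sH) Hlink) sub2.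
Qed.
End KK.

(** * Densities of initial segments *)

Local Open Scope ring_scope.

(* The density of [w] among the d-subsets of an N-point set. *)
Fixpoint wmu (w : word) (N d : nat) : rat :=
  match w with
  | Wnone => 0
  | Wall => 1
  | Wand u => (1 - d%:R / N%:R) * wmu u N.-1 d
  | Wor u => 1 - d%:R / N%:R * (1 - wmu u N.-1 d.-1)
  end.

Lemma ratio_bounds (d N : nat) : (d <= N)%N -> 0 <= (d%:R / N%:R : rat) <= 1.
Proof.
case: N => [|N] dN; first by rewrite invr0 mulr0 ler01 lexx.
by rewrite divr_ge0 // ler_pdivrMr ?mul1r ?ler_nat.
Qed.

Lemma wmu_bounds w N m : wvalid w N m -> 0 <= wmu w N m <= 1.
Proof.
elim: w N m => [|||] //=.
- move=> u IH N m /andP[mN /IH]; have := ratio_bounds (ltnW mN).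
  by move: (_ / _) (wmu _ _ _) => a b; nra.
- move=> u IH N [|m] /andP[mN Vu]; first by rewrite !mul0r subr0 ler01 lexx.
  have := ratio_bounds (ltnW mN); have := IH _ _ Vu.
  by move: (_ / _) (wmu _ _ _) => a b; rewrite /=; nra.
Qed.

Lemma wcardE w N m : wvalid w N m -> (wcard w N m)%:R = wmu w N m * 'C(N, m)%:R.
Proof.
elim: w N m => [|||] /=.
- by move=> N m _; rewrite mul0r.
- by move=> N m _; rewrite mul1r.
- move=> u IH N m /andP[mN Vu]; rewrite (IH _ _ Vu).
  have N0 : N%:R != 0 :> rat by rewrite pnatr_eq0; lia.
  have := congr1 (fun k => k%:R : rat) (mul_bin_down N m).
  rewrite !natrM natrB ?(ltnW mN) // => E.
  apply: (mulfI N0); rewrite mulrCA E; field; exact: N0.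
- move=> u IH N [|m] /andP[mN Vu].
    by rewrite !bin0 !mul0r subr0 mulr1.
  rewrite natrD (IH _ _ Vu) /=.
  have N0 : N%:R != 0 :> rat by rewrite pnatr_eq0; lia.
  have := congr1 (fun k => k%:R : rat) (mul_bin_down N m.+1).
  rewrite !natrM natrB ?(ltnW mN) // => E1.
  have := congr1 (fun k => k%:R : rat) (mul_bin_diag N m); rewrite !natrM => E2.
  apply: (mulfI N0); rewrite mulrDr E1 mulrCA E2; field; exact: N0.
Qed.

Lemma wmu_le w N m d : wvalid w N m -> (d <= m)%N -> wmu w N m <= wmu w N d.
Proof.
elim: w N m d => [|||] //=.
- move=> u IH N m d /andP[mN Vu] dm; have le := IH _ _ _ Vu dm.
  have [b1 b2] := andP (wmu_bounds Vu).
  have [c1 c2] := andP (ratio_bounds (ltnW mN)).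
  apply: ler_pM => //; first by rewrite subr_ge0.
  by rewrite lerB // ler_wpM2r ?invr_ge0 ?ler_nat.
- move=> u IH N [|m] [|d] //= /andP[mN Vu] dm.
    have := wmu_bounds Vu; have := ratio_bounds (ltnW mN).
    by rewrite !mul0r; move: (_ / _) (wmu _ _ _) => a b; nra.
  have le := IH _ _ _ Vu dm; rewrite lerB // ler_pM ?lerB //.
  - by rewrite divr_ge0.
  - by have := wmu_bounds (wvalidW (_ : d <= m)%N Vu); move=> /(_ dm); lra.
  - by rewrite ler_wpM2r ?invr_ge0 ?ler_nat.
Qed.

(** Already the first letter separates the levels, unless the rest has density 0 under [Wand] or 1
    under [Wor], which the hypothesis excludes. *)
Lemma wmu_lt w N m d : wvalid w N m -> (d < m)%N -> 0 < wmu w N m < 1 ->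
  wmu w N m < wmu w N d.
Proof.
case: w => [|||] /=; rewrite ?ltxx //= ?andbF //.
- move=> u /andP[mN Vu] dm /andP[p0 _]; have le := wmu_le Vu (ltnW dm).
  have c0 : 0 < wmu u N.-1 m.
    have := wmu_bounds Vu; have := ratio_bounds (ltnW mN); move: p0.
    by move: (_ / _) (wmu _ _ _) => a b; nra.
  have lt : d%:R / N%:R < m%:R / N%:R :> rat.
    by rewrite ltr_pM2r ?invr_gt0 ?ltr0n ?ltr_nat //; lia.
  have := ratio_bounds (ltnW mN); move: (d%:R / _) (m%:R / _) lt le c0 => a b.
  by move: (wmu _ _ m) (wmu _ _ d) => x y; nra.
move=> u; case: m => [|m] //= /andP[mN Vu] dm /andP[_ p1].
have lt : d%:R / N%:R < m.+1%:R / N%:R :> rat.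
  by rewrite ltr_pM2r ?invr_gt0 ?ltr0n ?ltr_nat //; lia.
have d0 : 0 <= d%:R / N%:R :> rat by rewrite divr_ge0.
have dm' : (d.-1 <= m)%N by lia.
have le := wmu_le Vu dm'; have := wmu_bounds Vu.
move: lt d0 p1 le; move: (d%:R / _) (m.+1%:R / _) (wmu _ _ m) (wmu _ _ d.-1) => a b x y ab a0 p1 xy b01.
have x1 : x < 1 by nra.
have h1 : a * (1 - y) <= a * (1 - x) by nra.
have h2 : a * (1 - x) < b * (1 - x) by nra.
lra.
Qed.

Lemma wmu0_gt0 w N : 0 < wmu w N 0 -> wmu w N 0 = 1.
Proof.
elim: w N => [|||] //=.
- by move=> u IH N; rewrite !mul0r subr0 !mul1r; apply: IH.
- by move=> u _ N _; rewrite !mul0r subr0.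
Qed.

(** The core of the trade inequality for words [Wor (Wand _)]: M is N - m, x is m - d, u is the
    density of the remaining word and 1 - v that of [Wand _]. Both u and v are affine in w = 1 - v,
    so a polynomial inequality in w remains. *)
Lemma trade_polynomial (M m x u v : rat) : 1 <= M -> 1 <= m -> 0 <= x -> x <= m - 1 ->
  0 <= u -> 0 < v -> v = 1 - M / (M + m - 1) * u ->
  (M + 1 + x) * (1 - (M + x) / (M + m - 1) * u) * (1 - m / (M + m) * v) < (M + 1) * v.
Proof.
move=> M1 m1 x0 xm u0 v0 ev.
pose w := 1 - v.
have K0 : M + m - 1 != 0 by apply: lt0r_neq0; lra.
have N0 : M + m != 0 by apply: lt0r_neq0; lra.
have Mn0 : M != 0 by apply: lt0r_neq0; lra.
have eu : (M + x) / (M + m - 1) * u = (M + x) * w / M.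
  by rewrite /w ev; field; rewrite K0 Mn0.
have w0 : 0 <= w.
  have : 0 <= M / (M + m - 1) * u by rewrite mulr_ge0 // divr_ge0; lra.
  rewrite /w ev; lra.
have MN : 0 < M * (M + m) by apply: mulr_gt0; lra.
rewrite eu -(ltr_pM2l MN).
have -> : M * (M + m) * ((M + 1 + x) * (1 - (M + x) * w / M) * (1 - m / (M + m) * v)) =
   ((M + 1) * M * v + x * (M * (1 - 2 * w) - w * (1 + x))) * (M + m * w).
  by rewrite /w; field; rewrite N0 Mn0.
have -> : v = 1 - w by rewrite /w; ring.
have w1 : w < 1 by rewrite /w; lra.
move: (w) w0 w1 => {ev eu v0 v u0 u} {}w w0 w1.
set b := M * (1 - 2 * w) - w * (1 + x).
suff : x * b * (M + m * w) < (M + 1) * M * m * (1 - w) ^+ 2.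
  have -> : M * (M + m) * ((M + 1) * (1 - w)) = (M + 1) * M * (1 - w) * (M + m * w) + (M + 1) * M * m * (1 - w) ^+ 2.
    by ring.
  by rewrite mulrDl; lra.
have R0 : 0 < (M + 1) * M * m * (1 - w) ^+ 2.
  by rewrite !mulr_gt0 ?exprn_gt0 //; lra.
have [b0|b0] := lerP b 0.
  apply: le_lt_trans R0; rewrite -mulrA; apply: mulr_ge0_le0 => //.
  by apply: mulr_le0_ge0 => //; apply: addr_ge0; [lra|apply: mulr_ge0; lra].
rewrite -subr_gt0.
have bE : M * (1 - 2 * w) - w * x = b + w by rewrite /b; ring.
have w2 : 0 < 1 - 2 * w.
  have : 0 < M * (1 - 2 * w) by have := mulr_ge0 w0 x0; rewrite /b in b0; lra.
  by rewrite pmulr_rgt0 //; lra.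
(* A positivity certificate: no summand is negative, because x <= m - 1, w < 1/2 and b > 0, and the
   second one is positive. *)
have -> : (M + 1) * M * m * (1 - w) ^+ 2 - x * b * (M + m * w) =
  M * (m - 1 - x) * (b + w) + M ^+ 2 * (1 - 2 * w) + M ^+ 2 * m * w ^+ 2
   + M * m * (1 - w) ^+ 2 + 2 * M * m * w ^+ 2 * x + m * w ^+ 2 * x * (1 + x).
  by rewrite /b; ring.
have h1 : 0 <= M * (m - 1 - x) * (b + w) by rewrite !mulr_ge0 //; lra.
have h2 : 0 < M ^+ 2 * (1 - 2 * w) by rewrite mulr_gt0 // exprn_gt0; lra.
have h3 : 0 <= M ^+ 2 * m * w ^+ 2 by rewrite !mulr_ge0 ?sqr_ge0 //; lra.
have h4 : 0 <= M * m * (1 - w) ^+ 2 by rewrite !mulr_ge0 ?sqr_ge0 //; lra.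
have h5 : 0 <= 2 * M * m * w ^+ 2 * x by rewrite !mulr_ge0 ?sqr_ge0 //; lra.
have h6 : 0 <= m * w ^+ 2 * x * (1 + x) by rewrite !mulr_ge0 ?sqr_ge0 //; lra.
lra.
Qed.

Lemma pred_natr (n : nat) : (0 < n)%N -> n.-1%:R = n%:R - 1 :> rat.
Proof. by case: n => // n _; rewrite -natr1 addrK. Qed.

(** The factor d/N common to both sides cancels and leaves a comparison on N - 1 points, decided by
    the second letter: [Wnone] and [Wand] by [trade_polynomial], another [Wor] by the quadratic
    bound [h1]; [Wall] would give density 1. *)
Lemma wor_trade (R : rat) u N m d : 1 <= R -> N.+1%:R - m%:R <= R * m%:R ->
  wvalid (Wor u) N m -> (0 < d <= m)%N ->
  0 < wmu (Wor u) N m -> wmu (Wor u) N m < 1 ->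
  (N.+1%:R - d%:R) * (1 - wmu (Wor u) N d) * wmu (Wor u) N m
    < d%:R * R * (1 - wmu (Wor u) N m).
Proof.
move=> R1 Rm V /andP[d0 dm] p0 p1.
have /andP[mN Vu] : (m < N)%N && wvalid u N.-1 m.-1.
  by case: m V dm {Rm p0 p1} => [|m] /= V dm //; move: d0; rewrite (leqn0 d) in dm *; case: d dm.
have m0 : (0 < m)%N := leq_trans d0 dm.
have N0 : (0 < N)%N := ltn_trans m0 mN.
have N1 : (1 < N)%N := leq_ltn_trans m0 mN.
have cE : wmu (Wor u) N m = 1 - m%:R / N%:R * (1 - wmu u N.-1 m.-1) by [].
have yE : wmu (Wor u) N d = 1 - d%:R / N%:R * (1 - wmu u N.-1 d.-1) by [].
have nd0 : 0 < d%:R :> rat by rewrite ltr0n.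
have nN0 : 0 < N%:R :> rat by rewrite ltr0n.
have nm1 : 1 <= m%:R :> rat by rewrite ler1n.
have ndm : d%:R <= m%:R :> rat by rewrite ler_nat.
have nmN : m%:R + 1 <= N%:R :> rat by rewrite natr1 ler_nat.
have nd1 : 1 <= d%:R :> rat by rewrite ler1n.
rewrite -natr1 in Rm *.
suff H : (N%:R + 1 - d%:R) * (1 - wmu u N.-1 d.-1) * wmu (Wor u) N m
     < R * m%:R * (1 - wmu u N.-1 m.-1).
  have dN : 0 < d%:R / N%:R :> rat by rewrite divr_gt0.
  have := H; rewrite -(ltr_pM2l dN) yE [in X in _ -> _ < X]cE.
  set c := wmu (Wor u) N m => {}H.
  have -> : d%:R * R * (1 - (1 - m%:R / N%:R * (1 - wmu u N.-1 m.-1))) = d%:R / N%:R * (R * m%:R * (1 - wmu u N.-1 m.-1)) by ring.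
  rewrite -[X in X < _](_ : d%:R / N%:R * ((N%:R + 1 - d%:R) * (1 - wmu u N.-1 d.-1) * c) = _) //; ring.
have c1 : 0 < 1 - wmu u N.-1 m.-1.
  by move: p1; rewrite cE gtrBl pmulr_rgt0 // divr_gt0 //; lra.
have poly x : wmu u N.-1 m.-1 = (1 - m.-1%:R / N.-1%:R) * x -> 0 <= x ->
    1 - wmu u N.-1 d.-1 <= 1 - (1 - d.-1%:R / N.-1%:R) * x ->
    (N%:R + 1 - d%:R) * (1 - wmu u N.-1 d.-1) * wmu (Wor u) N m
      < R * m%:R * (1 - wmu u N.-1 m.-1).
  move=> ec x0 ey.
  have H := @trade_polynomial (N%:R - m%:R) m%:R (m%:R - d%:R) x (1 - wmu u N.-1 m.-1).
  have {H} := H (ltac:(lra)) (ltac:(lra)) (ltac:(lra)) (ltac:(lra)) x0 c1.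
  have -> : N%:R - m%:R + m%:R - 1 = N.-1%:R :> rat by rewrite pred_natr //; ring.
  have -> : N%:R - m%:R + m%:R = N%:R :> rat by ring.
  have NN : N.-1%:R != 0 :> rat by rewrite pred_natr // ; apply: lt0r_neq0; lra.
  have -> : (N%:R - m%:R) / N.-1%:R = 1 - m.-1%:R / N.-1%:R :> rat.
    by rewrite !pred_natr // in NN *; field.
  have -> : (N%:R - m%:R + (m%:R - d%:R)) / N.-1%:R = 1 - d.-1%:R / N.-1%:R :> rat.
    by rewrite !pred_natr // in NN *; field.
  rewrite -ec -cE => H; apply: le_lt_trans (lt_le_trans (H _) _); last first.
  - by rewrite ler_pM2r // (le_trans _ Rm) //; lra.
  - by rewrite ec; ring.
  rewrite ler_pM2r //.
  rewrite (_ : _ + 1 + (_ - _) = N%:R + 1 - d%:R); last by ring.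
  by rewrite ler_pM2l //; lra.
case: u V Vu p0 p1 cE yE poly c1 => [||u|u] V Vu p0 p1 cE yE poly c1.
- by apply: (poly 0); rewrite /= ?mulr0.
- by move: c1; rewrite subrr ltxx.
- have /andP[_ Vu'] := Vu.
  have d1m1 : (d.-1 <= m.-1)%N by case: (d) (m) dm => [|?] [|?].
  apply: (poly (wmu u N.-1.-1 m.-1)) => //; first by have /andP[] := wmu_bounds Vu'.
  rewrite lerB //= ler_wpM2l ?(wmu_le Vu') // subr_ge0.
  have /andP[mN1 _] := Vu.
  by have /andP[_ ->] := ratio_bounds (leq_trans d1m1 (ltnW mN1)).
have m1 : (1 < m)%N.
  case: (m) m0 c1 => [|[|k]] //= _; rewrite /=; rewrite !mul0r subr0 subrr ltxx //.
have /andP[mN1 Vu'] : (m.-1 < N.-1)%N && wvalid u N.-1.-1 m.-2.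
  by case: (m) m1 Vu => [|[|k]] //= _.
have d2m2 : (d.-2 <= m.-2)%N by case: (d) (m) dm => [|[|?]] [|[|?]].
have wle := wmu_le Vu' d2m2.
have nN1 : 0 < N.-1%:R :> rat by rewrite ltr0n; case: (N) N1 => [|[|?]].
have cE1 : 1 - wmu (Wor u) N.-1 m.-1 = m.-1%:R / N.-1%:R * (1 - wmu u N.-1.-1 m.-2) by rewrite /=; ring.
have yE1 : 1 - wmu (Wor u) N.-1 d.-1 = d.-1%:R / N.-1%:R * (1 - wmu u N.-1.-1 d.-2) by rewrite /=; ring.
have nm2 : 0 < m.-1%:R :> rat by rewrite ltr0n; case: (m) m1 => [|[|?]].
have c2 : 0 < 1 - wmu u N.-1.-1 m.-2 by move: c1; rewrite cE1 pmulr_rgt0 // divr_gt0.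
rewrite cE1 yE1 !pred_natr // in nm2 nN1 *.
set c := wmu (Wor (Wor u)) N m in p0 p1 *.
move: wle c2; set y := wmu u N.-1.-1 d.-2; set x := wmu u N.-1.-1 m.-2 => wle c2.
have k1 : 0 < (N%:R - 1)^-1 :> rat by rewrite invr_gt0.
rewrite -(ltr_pM2r nN1).
rewrite [X in _ < X](_ : _ = R * m%:R * (m%:R - 1) * (1 - x)); last by field; apply: lt0r_neq0.
rewrite [X in X < _](_ : _ = (N%:R + 1 - d%:R) * (d%:R - 1) * (1 - y) * c); last by field; apply: lt0r_neq0.
have h1 : (N%:R + 1 - d%:R) * (d%:R - 1) <= R * m%:R * (m%:R - 1) :> rat.
  have h2 : N%:R + 1 - d%:R <= (R + 1) * m%:R - d%:R :> rat by lra.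
  apply: le_trans (_ : ((R + 1) * m%:R - d%:R) * (d%:R - 1) <= _).
    by apply: ler_wpM2r => //; lra.
  rewrite -subr_ge0.
  rewrite (_ : _ - _ = (m%:R - d%:R) * ((R - 1) * m%:R + (m%:R - d%:R) + 1)); last by ring.
  by apply: mulr_ge0; [lra|have : 0 <= (R - 1) * m%:R by apply: mulr_ge0; lra]; lra.
have h3 : 0 <= (N%:R + 1 - d%:R) * (d%:R - 1) :> rat by apply: mulr_ge0; lra.
have R0 : 0 < R * m%:R * (m%:R - 1) * (1 - x) by rewrite !mulr_gt0 //; lra.
apply: le_lt_trans (_ : R * m%:R * (m%:R - 1) * (1 - x) * c < _).
  rewrite ler_pM2r //; apply: ler_pM => //; last by lra.
  by have := wmu_bounds (wvalidW d2m2 Vu'); rewrite -/y; lra.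
by rewrite gtr_pMr.
Qed.

(* With N + 1 = n and R = r - 1: the loss at level d of a family contained in a
   star is less than d (r - 1) times its deficiency 1 / c - 1.  Being linear in d,
   the bound can be averaged over the distributions of the remaining levels. *)
Lemma wmu_trade (R : rat) w N m d : 1 <= R -> N.+1%:R - m%:R <= R * m%:R ->
  wvalid w N m -> (0 < d <= m)%N -> 0 < wmu w N m -> wmu w N m < 1 ->
  (N.+1%:R - d%:R) * (1 - wmu w N d) * wmu w N m < d%:R * R * (1 - wmu w N m).
Proof.
elim: w N => [|||] /=; first by move=> N _ _ _ _; rewrite ltxx.
  by move=> N _ _ _ _ _; rewrite ltxx.
- move=> u IH N R1 Rm /andP[mN Vu] /andP[d0 dm] p0 p1.
  have N0 : (0 < N)%N by case: (N) mN.
  have nN : 0 < N%:R :> rat by rewrite ltr0n.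
  have nmN : m%:R + 1 <= N%:R :> rat by rewrite natr1 ler_nat.
  have ndm : d%:R <= m%:R :> rat by rewrite ler_nat.
  have nd1 : 1 <= d%:R :> rat by rewrite ler1n.
  have [c0 c1] := andP (wmu_bounds Vu).
  have [y0 y1] := andP (wmu_bounds (wvalidW dm Vu)).
  have cy := wmu_le Vu dm.
  have cpos : 0 < wmu u N.-1 m.
    by rewrite lt_neqAle c0 andbT eq_sym; apply: contraTneq p0 => ->; rewrite mulr0 ltxx.
  (* Kept non-strict because the rest may have density 1. Strictness returns at the end, from R m >=
     N + 1 - m > N - m. *)
  have le : (N%:R - d%:R) * (1 - wmu u N.-1 d) * wmu u N.-1 m <= d%:R * R * (1 - wmu u N.-1 m).
    have [e1|ne1] := eqVneq (wmu u N.-1 m) 1.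
      have -> : wmu u N.-1 d = 1 by apply/eqP; rewrite eq_le y1 -e1 cy.
      by rewrite subrr mulr0 mul0r mulr_ge0 ?subr_ge0 // mulr_ge0; lra.
    have := IH N.-1; rewrite prednK // => IH'; apply/ltW/IH' => //.
    - by move: Rm; rewrite -natr1; lra.
    - by rewrite d0.
    - by rewrite lt_neqAle ne1.
  rewrite -natr1 in Rm *.
  move: cpos c1 y0 y1 cy le => {p0 p1 c0 IH}.
  move: (wmu u N.-1 m) (wmu u N.-1 d) => c y c0 c1 y0 y1 cy le.
  move: nN nmN ndm nd1 Rm le; move: (N%:R : rat) (m%:R : rat) (d%:R : rat) => {Vu mN d0 dm N0 N m d} N m d nN nmN ndm nd1 Rm le.
  rewrite -(ltr_pM2r nN) -(ltr_pM2r nN).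
  have -> : (N + 1 - d) * (1 - (1 - d / N) * y) * ((1 - m / N) * c) * N * N = (N - m) * c * ((N + 1 - d) * d + (N + 1 - d) * (N - d) * (1 - y)) by field; lra.
  have -> : d * R * (1 - (1 - m / N) * c) * N * N = d * R * (N - (N - m) * c) * N by field; lra.
  have h1 : (N + 1 - d) * d + (N + 1 - d) * (N - d) * (1 - y) <= N * (d + (N - d) * (1 - y)).
    rewrite -subr_ge0 (_ : _ - _ = (d - 1) * (d + (N - d) * (1 - y))); last by ring.
    by apply: mulr_ge0; [lra|apply: addr_ge0; [lra|apply: mulr_ge0; lra]].
  apply: le_lt_trans (_ : (N - m) * c * (N * (d + (N - d) * (1 - y))) < _).
    by apply: ler_wpM2l => //; apply: mulr_ge0; lra.
  have -> : (N - m) * c * (N * (d + (N - d) * (1 - y))) = N * (N - m) * (d * c + (N - d) * (1 - y) * c) by ring.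
  apply: le_lt_trans (_ : N * (N - m) * (d * c + d * R * (1 - c)) < _).
    by apply: ler_wpM2l; [apply: mulr_ge0; lra|lra].
  rewrite -subr_gt0 (_ : _ - _ = N * d * (R * m - (N - m) * c)); last by ring.
  apply: mulr_gt0; first by apply: mulr_gt0; lra.
  have : (N - m) * c <= (N - m) * 1 by apply: ler_wpM2l; lra.
  lra.
move=> u _ N R1 Rm V dm p0 p1; exact: wor_trade.
Qed.

(* The sum of these factors replaces minus the logarithm of the density, so that
   the computation stays in the rationals. *)
Fixpoint wfactors (w : word) (N m : nat) : seq rat :=
  if w is Wand u then m%:R / N%:R :: wfactors u N.-1 m else [:: 1 - wmu w N m].

Lemma wfactors_prod w N m : \prod_(a <- wfactors w N m) (1 - a) = wmu w N m.
Proof.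
elim: w N => [||u IH|u _] N; rewrite /= ?big_seq1 ?subKr //.
by rewrite big_cons IH.
Qed.

Lemma wfactors_bounds w N m : wvalid w N m -> all (fun a => 0 <= a <= 1) (wfactors w N m).
Proof.
elim: w N => [||u IH|u _] N V.
- by [].
- by [].
- by have /andP[mN Vu] := V; rewrite /= IH // ratio_bounds // ltnW.
- have [c0 c1] := andP (wmu_bounds V); apply/allP => a.
  by rewrite mem_seq1 => /eqP->; rewrite subr_ge0 c1 gerBl c0.
Qed.

(** With q = n / (R + 1), the difference (e (R - 1) + q) q - (n - e) e is the square of e - q; this
    is the origin of the coefficient. As m >= q, each letter [Wand] pays for its factor by this
    estimate. *)
Lemma wfactors_sum (R : rat) w N m d : 1 <= R -> N.+1%:R <= (R + 1) * m%:R ->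
  wvalid w N m -> (0 < d <= m)%N -> 0 < wmu w N m ->
  (N.+1%:R - d%:R) * (1 - wmu w N d)
    <= (d%:R * (R - 1) + N.+1%:R / (R + 1)) * \sum_(a <- wfactors w N m) a.
Proof.
move=> R1.
have key (n e k : rat) : 0 <= e -> 0 <= n -> n <= (R + 1) * k ->
    (n - e) * e <= (e * (R - 1) + n / (R + 1)) * k.
  move=> e0 n0 nk.
  have h0 : 0 <= e * (R - 1) + n / (R + 1).
    by apply: addr_ge0; [apply: mulr_ge0|apply: divr_ge0]; lra.
  have h1 : n / (R + 1) <= k by rewrite ler_pdivrMr; lra.
  apply: le_trans (ler_wpM2l h0 h1); rewrite -subr_ge0.
  rewrite (_ : _ - _ = (e - n / (R + 1)) ^+ 2) ?sqr_ge0 //.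
  by field; lra.
have coef (n e : nat) : 0 <= e%:R * (R - 1) + n%:R / (R + 1).
  by apply: addr_ge0; [apply: mulr_ge0|apply: divr_ge0]; rewrite ?ler0n //; lra.
elim: w N => [||u IH|u _] N Rm V /andP[d0 dm] p0.
- by rewrite /= ltxx in p0.
- by rewrite /= subrr mulr0 big_seq1 mulr0.
- have /andP[mN Vu] := V.
  have N0 : (0 < N)%N by case: (N) mN.
  have nN : 0 < N%:R :> rat by rewrite ltr0n.
  have ndm : d%:R <= m%:R :> rat by rewrite ler_nat.
  have nd1 : 1 <= d%:R :> rat by rewrite ler1n.
  have nmN : m%:R + 1 <= N%:R :> rat by rewrite natr1 ler_nat.
  have [c0 c1] := andP (wmu_bounds Vu).
  have [y0 y1] := andP (wmu_bounds (wvalidW dm Vu)).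
  have cpos : 0 < wmu u N.-1 m.
    rewrite lt_neqAle c0 andbT eq_sym; apply: contraTneq p0 => /= ->.
    by rewrite mulr0 ltxx.
  have := IH N.-1; rewrite prednK // => IH'.
  have {}IH' : (N%:R - d%:R) * (1 - wmu u N.-1 d)
    <= (d%:R * (R - 1) + N%:R / (R + 1)) * \sum_(a <- wfactors u N.-1 m) a.
    by apply: IH' => //; [move: Rm; rewrite -natr1; lra|rewrite d0].
  rewrite -natr1 in Rm; rewrite /= big_cons -natr1.
  set L := \sum_(a <- _) a in IH' *.
  have L0 : 0 <= L.
    rewrite /L big_seq; apply: sumr_ge0 => a; move/(allP (wfactors_bounds Vu)).
    by case/andP.
  have h1 : (d%:R * (R - 1) + N%:R / (R + 1)) * L <= (d%:R * (R - 1) + (N%:R + 1) / (R + 1)) * L.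
    by apply: ler_wpM2r => //; rewrite lerD2l ler_pM2r ?invr_gt0; lra.
  rewrite [X in _ <= X]mulrDr.
  apply: (@le_trans _ _ ((N%:R + 1 - d%:R) * d%:R / N%:R + (N%:R - d%:R) * (1 - wmu u N.-1 d))); last first.
    apply: lerD; last exact: le_trans IH' h1.
    by rewrite mulrA ler_pM2r ?invr_gt0 //; apply: key; rewrite ?ler0n //; lra.
  rewrite -(ler_pM2r nN) -subr_ge0.
  rewrite (_ : _ - _ = (d%:R - 1) * (N%:R - d%:R) * (1 - wmu u N.-1 d)); last by field; lra.
  by apply: mulr_ge0; [apply: mulr_ge0|]; lra.
rewrite /= big_seq1 /=.
case: m V dm Rm p0 => [|m] V dm Rm p0; first by case: d d0 dm.
have /andP[mN Vu] := V.
have dm' : (d.-1 <= m)%N by case: d d0 dm.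
have wle := wmu_le Vu dm'.
have N0 : 0 < N%:R :> rat by rewrite ltr0n; case: (N) mN.
have [c0 c1] := andP (wmu_bounds Vu).
have ndm : d%:R <= m.+1%:R :> rat by rewrite ler_nat.
have nmN : m.+1%:R + 1 <= N%:R :> rat by rewrite natr1 ler_nat.
rewrite !subKr.
rewrite !mulrA [X in _ <= X](_ : _ = (d%:R * (R - 1) + N.+1%:R / (R + 1)) * m.+1%:R / N%:R * (1 - wmu u N.-1 m)); last by ring.
apply: ler_pM.
- apply: divr_ge0; last by lra.
  by apply: mulr_ge0; rewrite ?ler0n // -natr1; lra.
- by have /andP[_] := wmu_bounds (wvalidW dm' Vu); lra.
- by rewrite ler_pM2r ?invr_gt0 //; apply: key; rewrite ?ler0n.
- by lra.
Qed.

(** * The product inequality from excesses and deficiencies *)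

(** The means inequality bounds the product by a power of a mean that is at most 1. Equality there
    would make all factors equal to one that exceeds 1. *)
Lemma prod_1B_lt1 (s : seq rat) : all (fun a => a <= 1) s -> 0 <= \sum_(a <- s) a ->
  has (fun a => a < 0) s -> \prod_(a <- s) (1 - a) < 1.
Proof.
move=> /allP s1 s0 /hasP[a0 a0s a00].
pose E (i : 'I_(size s)) := 1 - s`_i.
have E0 : {in 'I_(size s), forall i, 0 <= E i}.
  by move=> i _; rewrite subr_ge0 s1 // mem_nth.
have sz : (0 < size s)%N by case: (s) a0s.
have ksz : (size s)%:R != 0 :> rat by rewrite pnatr_eq0 -lt0n.
have AG := leif_AGM E0.
have eP : \prod_(a <- s) (1 - a) = \prod_(i in 'I_(size s)) E i.
  by rewrite (big_nth 0) big_mkord.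
have meanE : (\sum_(i in 'I_(size s)) E i) / #|'I_(size s)|%:R = 1 - (\sum_(a <- s) a) / (size s)%:R.
  rewrite card_ord sumrB sumr_const card_ord mulrBl divff //; congr (1 - _ / _).
  by rewrite (big_nth 0) big_mkord.
rewrite meanE in AG.
have mean1 : 1 - (\sum_(a <- s) a) / (size s)%:R <= 1 by rewrite gerBl divr_ge0.
have mean0 : 0 <= 1 - (\sum_(a <- s) a) / (size s)%:R.
  by rewrite -meanE divr_ge0 // sumr_ge0 // => i _; apply: E0.
have pow1 := exprn_ile1 #|'I_(size s)| mean0 mean1.
rewrite eP; apply: (lt_le_trans _ pow1); rewrite (lt_leif AG); apply/negP => /forallP eqE.
have i0P : (index a0 s < size s)%N by rewrite index_mem.
pose i0 := Ordinal i0P.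
have v1 : 1 < E i0 by rewrite /E /= nth_index //; lra.
have : \prod_(i in 'I_(size s)) E i = E i0 ^+ size s.
  rewrite -[X in _ ^+ X]card_ord -prodr_const; apply: eq_bigr => i _.
  by have /forallP /(_ i) /eqP -> := eqE i0.
move=> e; have := le_trans AG.1 pow1; rewrite e leNgt => /negP; apply.
by rewrite exprn_egt1 // -lt0n.
Qed.

(* Chebyshev's inequality: give the smallest weights the largest shares. *)
Lemma balanced_allocation (I : finType) (A : {set I}) (w : I -> rat) (M K : nat) :
  (K <= #|A| * M)%N ->
  exists d : I -> nat, [/\ forall i, (d i <= M)%N, (\sum_(i in A) d i = K)%N &
    #|A|%:R * \sum_(i in A) (d i)%:R * w i <= K%:R * \sum_(i in A) w i].
Proof.
move eqt: #|A| => t; elim: t A K eqt => [|t IH] A K cA leK.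
  exists (fun=> 0%N); have -> : A = set0 by apply/eqP; rewrite -cards_eq0 cA.
  by split=> //; rewrite ?big_set0 ?mul0r ?mulr0 //; case: K leK.
have [i0 i0A] : exists i0, i0 \in A by apply/card_gt0P; rewrite cA.
have [j jA jmax] := @Order.TotalTheory.arg_maxP _ _ _ i0 (fun i => i \in A) w i0A.
have cAj : #|A :\ j| = t by have := cardsD1 j A; rewrite jA cA; lia.
have leW : \sum_(i in A :\ j) w i <= t%:R * w j.
  rewrite -cAj mulr_natl -sumr_const; apply: ler_sum => i; rewrite in_setD1 => /andP[_ iA].
  exact: jmax.
have [leK'|ltK] := leqP K (t * M).
  have [d [dM dK dw]] := IH _ _ cAj leK'.
  exists (fun i => if i == j then 0%N else d i); split.
  - by move=> i; case: ifP.
  - rewrite (big_setD1 j) //= eqxx add0n -[in RHS]dK; apply: eq_bigr => i.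
    by rewrite in_setD1 => /andP[/negPf->].
  rewrite (big_setD1 j) //= eqxx mul0r add0r [X in _ <= _ * X](big_setD1 j) //=.
  rewrite (eq_bigr (fun i => (d i)%:R * w i)); last first.
    by move=> i; rewrite in_setD1 => /andP[/negPf->].
  set W := \sum_(i in A :\ j) w i in leW dw *; set D := \sum_(i in _) _ in dw *.
  have [t0|t0] := posnP t.
    have A0 : A :\ j = set0 by apply/eqP; rewrite -cards_eq0 cAj t0.
    have -> : K = 0%N by move: leK'; rewrite t0 mul0n leqn0 => /eqP.
    by rewrite /D A0 big_set0 mulr0 mul0r.
  have tp : 0 < t%:R :> rat by rewrite ltr0n.
  rewrite -(ler_pM2l tp) -natr1.
  have h : K%:R * W <= K%:R * (t%:R * w j) by apply: ler_wpM2l.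
  have h2 : (t%:R + 1) * (t%:R * D) <= (t%:R + 1) * (K%:R * W).
    by apply: ler_wpM2l => //; rewrite natr1.
  lra.
pose d i := if i == j then (K - t * M)%N else M.
exists d; split.
- by move=> i; rewrite /d; case: ifP => _ //; lia.
- rewrite (big_setD1 j) //= /d eqxx (eq_bigr (fun=> M)); last first.
    by move=> i; rewrite in_setD1 => /andP[/negPf->].
  by rewrite sum_nat_const cAj; lia.
rewrite (big_setD1 j) //= [X in _ <= _ * X](big_setD1 j) //= /d eqxx.
rewrite (eq_bigr (fun i => M%:R * w i)); last first.
  by move=> i; rewrite in_setD1 => /andP[/negPf->].
rewrite -mulr_sumr; set W := \sum_(i in A :\ j) w i in leW *.
rewrite natrB ?(ltnW ltK) // natrM -natr1.
have g0 : 0 <= (t.+1 * M)%:R - K%:R :> rat by rewrite subr_ge0 ler_nat.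
rewrite natrM -natr1 in g0.
have : ((t%:R + 1) * M%:R - K%:R) * W <= ((t%:R + 1) * M%:R - K%:R) * (t%:R * w j).
  exact: ler_wpM2l.
lra.
Qed.

Lemma extend_sum (I : finType) (a b : I -> nat) (n : nat) :
  (forall i, a i <= b i)%N -> (\sum_i a i <= n <= \sum_i b i)%N ->
  exists2 d : I -> nat, (forall i, a i <= d i <= b i)%N & (\sum_i d i = n)%N.
Proof.
move=> ab /andP[an nb]; rewrite -(subnKC an) in nb *.
elim: (n - _)%N nb => [|k IH] nb.
  by exists a; rewrite ?addn0 // => i; rewrite leqnn ab.
have [|d dP ds] := IH; first by apply: leq_trans nb; lia.
have [i lti] : exists i, (d i < b i)%N.
  apply/existsP; apply: contraLR nb; rewrite negb_exists -ltnNge => /forallP H.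
  rewrite addnS ltnS -ds; apply: leq_sum => i _; by have := H i; rewrite -leqNgt.
exists (fun j => if j == i then (d j).+1 else d j).
  move=> j; have := dP j; case: eqP => [->|_] //; lia.
rewrite (bigD1 i) //= eqxx addnS -ds [in RHS](bigD1 i) //= addSn; congr (_ + _).+1.
by apply: eq_bigr => j /negPf->.
Qed.

(* [c i] is the density divided by that of a star, and [h i d] is n times the
   difference of the densities of the shadow at level d and of that of a star. *)
Section Core.
Variables (I : finType) (n : nat) (m k : I -> nat) (h : I -> nat -> rat) (c : I -> rat)
  (fs : I -> seq rat).
Local Notation r := #|I|.
Hypothesis r2 : (2 <= r)%N.
Hypothesis mr : forall i, (n <= r * m i)%N.
Hypothesis km : forall i, (k i + m i = n)%N.
Hypothesis k0 : forall i, (0 < k i)%N.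
Hypothesis m0 : forall i, (0 < m i)%N.
Hypothesis c0 : forall i, 0 < c i.
Hypothesis hsum : forall d : I -> nat, (forall i, d i <= m i)%N -> (\sum_i d i = n)%N ->
  \sum_i h i (d i) <= 0.
Hypothesis hS : forall i d, 1 < c i -> (d <= m i)%N ->
  d%:R * (k i)%:R * (c i - 1) <= (m i)%:R * h i d.
Hypothesis hP : forall i d, c i <= 1 -> (d <= m i)%N ->
  - h i d <= d%:R * (r%:R - 1) * ((c i)^-1 - 1).
Hypothesis hP' : forall i d, c i < 1 -> (0 < d <= m i)%N ->
  - h i d < d%:R * (r%:R - 1) * ((c i)^-1 - 1).
Hypothesis fs1 : forall i, c i <= 1 -> all (fun a => 0 <= a <= 1) (fs i).
Hypothesis fsc : forall i, c i <= 1 -> \prod_(a <- fs i) (1 - a) = c i.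
Hypothesis hQ : forall i d, c i <= 1 -> (d <= m i)%N ->
  - h i d <= (d%:R * (r%:R - 2) + n%:R / r%:R) * \sum_(a <- fs i) a.

Let S := [set i | 1 < c i].

Lemma prod_le1 (A : {pred I}) (f : I -> rat) : (forall i, i \in A -> 0 <= f i <= 1) ->
  0 <= \prod_(i in A) f i <= 1.
Proof.
move=> f01; apply/andP; split; first by apply: prodr_ge0 => i /f01 /andP[].
exact: prodr_ile1.
Qed.

Lemma no_excess : S = set0 -> \prod_i c i <= 1 /\ (\prod_i c i = 1 -> forall i, c i = 1).
Proof.
move=> S0.
have c1 i : c i <= 1 by rewrite leNgt; have := in_set0 i; rewrite -S0 inE => ->.
have c01 i : 0 <= c i <= 1 by rewrite c1 ltW.
split=> [|e i]; first by have /andP[] := prod_le1 (A := predT) (fun i _ => c01 i).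
apply/eqP; rewrite eq_le c1 /= -e (bigD1 i) //=.
have /andP[_ rest1] := prod_le1 (A := [pred j | j != i]) (fun j _ => c01 j).
by rewrite ler_piMr // ltW.
Qed.

Lemma sum_splitS (f : I -> rat) : \sum_i f i = \sum_(i in S) f i + \sum_(i in ~: S) f i.
Proof.
rewrite (bigID (fun i => i \in S)) /=; congr (_ + _).
by apply: eq_bigl => i; rewrite in_setC.
Qed.

Lemma sum_splitSn (f : I -> nat) : (\sum_i f i = \sum_(i in S) f i + \sum_(i in ~: S) f i)%N.
Proof.
rewrite (bigID (fun i => i \in S)) /=; congr (_ + _)%N.
by apply: eq_bigl => i; rewrite in_setC.
Qed.

Lemma excess_ge0 i d : i \in S -> (d <= m i)%N -> 0 <= h i d.
Proof.
rewrite inE => ci dm; have := hS ci dm.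
have : 0 < (m i)%:R :> rat by rewrite ltr0n.
have : 0 <= d%:R * (k i)%:R * (c i - 1) by rewrite !mulr_ge0 //; lra.
by move=> p q r; rewrite -(pmulr_rge0 _ q); lra.
Qed.

Lemma deficiency0 i : i \notin S -> 0 <= h i 0.
Proof.
by rewrite inE -leNgt => ci; have := hP ci (leq0n _); rewrite !mul0r; lra.
Qed.

(** Otherwise levels supported on [S] could sum to n, and their excesses would make the sum in
    [hsum] positive. *)
Lemma excess_budget : S != set0 -> (0 < n)%N -> (\sum_(i in S) m i < n)%N.
Proof.
move=> /set0Pn[i0 i0S] n0; rewrite ltnNge; apply/negP => le.
pose b i := if i \in S then m i else 0%N.
have bE : (\sum_i b i = \sum_(i in S) m i)%N.
  by rewrite [in RHS]big_mkcond.
have [||d dP ds] := @extend_sum I (fun=> 0%N) b n; rewrite ?sum_nat_const ?muln0 ?bE //.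
have dm i : (d i <= m i)%N by have := dP i; rewrite /b; case: ifP; lia.
have dT i : i \notin S -> d i = 0%N by have := dP i; rewrite /b => /andP[_ H] /negPf e; move: H; rewrite e leqn0 => /eqP.
have [i di] : exists i, (0 < d i)%N.
  apply/existsP; apply: contraLR n0; rewrite negb_exists => /forallP H.
  by rewrite -ds big1 // => i _; apply/eqP; rewrite -leqn0 leqNgt; apply: H.
have iS : i \in S by apply: contraTT di => /dT ->.
have := hsum dm ds; rewrite leNgt => /negP; apply.
rewrite (bigD1 i) //= ltr_pwDl //; last first.
  apply: sumr_ge0 => j _; have [jS|jT] := boolP (j \in S); first exact: excess_ge0.
  by rewrite (dT j jT) deficiency0.
move: iS; rewrite inE => ci; have := hS ci (dm i).
have q : 0 < (m i)%:R :> rat by rewrite ltr0n.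
have p : 0 < (d i)%:R * (k i)%:R * (c i - 1) by rewrite !mulr_gt0 ?ltr0n //; lra.
by move=> p'; rewrite -(pmulr_rgt0 _ q); lra.
Qed.

(** The families of [S] take their full level m i, and [balanced_allocation] spreads the remaining K
    over the others, for whichever weights w measure the deficiency. *)
Lemma excess_allocation (w : I -> rat) : S != set0 -> (0 < n)%N ->
  exists d : I -> nat, [/\ forall i, i \in ~: S -> (d i <= m i)%N,
   \sum_(i in S) (k i)%:R * (c i - 1) <= \sum_(i in ~: S) - h i (d i) &
   #|~: S|%:R * \sum_(i in ~: S) (d i)%:R * w i
     <= (n%:R - \sum_(i in S) (m i)%:R) * \sum_(i in ~: S) w i].
Proof.
move=> Sn0 n0; have lt := excess_budget Sn0 n0.
set K := (n - \sum_(i in S) m i)%N; set t := #|~: S|.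
have sS : (#|S| + t = r)%N by rewrite cardsC.
have Sm : (#|S| * n <= r * \sum_(i in S) m i)%N.
  by rewrite big_distrr /= -sum_nat_const; apply: leq_sum => i _.
have Kr : (K * r <= t * n)%N.
  by move: Sm; rewrite /K mulnBl -sS; nia.
have t0 : (0 < t)%N.
  rewrite lt0n; apply/eqP => t0; move: Kr; rewrite t0 mul0n leqn0 muln_eq0.
  by rewrite /K subn_eq0 leqNgt lt /= => /eqP e; move: r2; rewrite e.
(* The cap M is K / t rounded up. It respects every m i: each member of [S] takes at least n / r, so
   K / t <= n / r <= m i. *)
pose M := ((K + t.-1) %/ t)%N.
have KM : (K <= t * M)%N.
  have := divn_eq (K + t.-1) t; have := ltn_pmod (K + t.-1) t0; rewrite -/M mulnC; lia.
have Mm i : (M <= m i)%N.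
  rewrite /M -ltnS ltn_divLR // mulSn.
  have le : (K * r <= t * m i * r)%N by apply: leq_trans Kr _; have := mr i; nia.
  have r0 : (0 < r)%N by lia.
  move: le; rewrite leq_pmul2r // => le; rewrite mulnC; lia.
have [d [dM dK dw]] := @balanced_allocation I (~: S) w M K KM.
exists d; split=> //.
- by move=> i _; apply: leq_trans (Mm i).
- pose d' i := if i \in S then m i else d i.
  have d'm i : (d' i <= m i)%N by rewrite /d'; case: ifP => // _; apply: leq_trans (Mm i).
  have d's : (\sum_i d' i = n)%N.
    have e1 : (\sum_(i in S) d' i = \sum_(i in S) m i)%N.
      by apply: eq_bigr => i; rewrite /d' => ->.
    have e2 : (\sum_(i in ~: S) d' i = K)%N.
      by rewrite -dK; apply: eq_bigr => i; rewrite in_setC /d' => /negPf->.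
    by rewrite sum_splitSn e1 e2 subnKC // ltnW.
  have := hsum d'm d's; rewrite sum_splitS sumrN.
  have -> : \sum_(i in ~: S) h i (d' i) = \sum_(i in ~: S) h i (d i).
    by apply: eq_bigr => i; rewrite in_setC /d' => /negPf->.
  suff : \sum_(i in S) (k i)%:R * (c i - 1) <= \sum_(i in S) h i (d' i) by lra.
  apply: ler_sum => i iS; rewrite /d' iS.
  have ci : 1 < c i by move: iS; rewrite inE.
  have q : 0 < (m i)%:R :> rat by rewrite ltr0n.
  by have := hS ci (leqnn _); rewrite -mulrA ler_pM2l.
by move: dw; rewrite /K natrB ?(ltnW lt) // natr_sum.
Qed.

Lemma sum_const_natl (A : {set I}) (x : rat) : \sum_(i in A) x = #|A|%:R * x.
Proof. by rewrite sumr_const mulr_natl. Qed.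

Lemma prod1D_ge (A : {set I}) (w : I -> rat) : (forall i, i \in A -> 0 <= w i) ->
  1 + \sum_(i in A) w i <= \prod_(i in A) (1 + w i).
Proof.
move=> w0.
suff [] : 1 + \sum_(i in A) w i <= \prod_(i in A) (1 + w i) /\ 0 <= \sum_(i in A) w i by [].
apply: (big_rec2 (fun s p => 1 + s <= p /\ 0 <= s)) => [|i y x iA [le y0]]; first by rewrite addr0.
have := w0 _ iA; split; last by apply: addr_ge0.
have : w i * (1 + y) <= w i * x by apply: ler_wpM2l.
have : 0 <= w i * y by apply: mulr_ge0.
lra.
Qed.

Lemma prod_splitS (f : I -> rat) : \prod_i f i = (\prod_(i in S) f i) * \prod_(i in ~: S) f i.
Proof.
rewrite (bigID (fun i => i \in S)) /=; congr (_ * _).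
by apply: eq_bigl => i; rewrite in_setC.
Qed.

Lemma deficient_le1 i : i \in ~: S -> c i <= 1.
Proof. by rewrite in_setC inE -leNgt. Qed.

(* A single excess may use up almost all of n, leaving small shares to the
   others; this is where the linear bound [hP] is needed. *)
Lemma one_excess : #|S| = 1%N -> (0 < n)%N -> \prod_i c i < 1.
Proof.
move=> S1 n0; have /eqP/cards1P[i0 Si0] := S1.
have Sn0 : S != set0 by rewrite -card_gt0 S1.
have i0S : i0 \in S by rewrite Si0 set11.
have e0 : 0 < c i0 - 1 by move: i0S; rewrite inE subr_gt0.
pose w i := (c i)^-1 - 1.
have w0 i : i \in ~: S -> 0 <= w i.
  by move=> /deficient_le1 ci; rewrite subr_ge0 invf_ge1.
have [d [dm dh dw]] := excess_allocation w Sn0 n0.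
have tE : #|~: S|%:R = r%:R - 1 :> rat by rewrite -(cardsC S) S1 natrD addrC addKr.
have kE : n%:R - (m i0)%:R = (k i0)%:R :> rat by rewrite -(km i0) natrD addrK.
have sumS (f : I -> rat) : \sum_(i in S) f i = f i0 by rewrite Si0 big_set1.
rewrite sumS in dh; rewrite sumS kE tE in dw.
have kp : 0 < (k i0)%:R :> rat by rewrite ltr0n.
have rp : 0 < r%:R - 1 :> rat by rewrite subr_gt0 ltr1n.
set W := \sum_(i in ~: S) w i in dw; set D := \sum_(i in ~: S) (d i)%:R * w i in dw.
have hD : \sum_(i in ~: S) - h i (d i) <= (r%:R - 1) * D.
  rewrite /D mulr_sumr; apply: ler_sum => i iT.
  by rewrite mulrCA mulrA hP ?deficient_le1 ?dm.
(* If W <= c i0 - 1, every instance of [hP] in use is an equality; by [hP'] each i outside [S] has d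
   i = 0 or c i = 1, so D = 0 and no loss balances the positive excess. *)
have eW : c i0 - 1 < W.
  rewrite ltNge; apply/negP => We.
  have eqs : \sum_(i in ~: S) ((d i)%:R * (r%:R - 1) * w i + h i (d i)) = 0.
    apply/eqP; rewrite eq_le; apply/andP; split; last first.
      by apply: sumr_ge0 => i iT; have := hP (deficient_le1 iT) (dm _ iT); rewrite /w; lra.
    rewrite big_split /= (eq_bigr (fun i => (r%:R - 1) * ((d i)%:R * w i))); last first.
      by move=> i _; ring.
    rewrite -mulr_sumr -/D; move: dh; rewrite sumrN.
    have : (k i0)%:R * W <= (k i0)%:R * (c i0 - 1) by rewrite ler_pM2l.
    lra.
  have pr j : j \in ~: S -> 0 <= (d j)%:R * (r%:R - 1) * w j + h j (d j).
    by move=> jT; have := hP (deficient_le1 jT) (dm _ jT); rewrite /w; lra.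
  have {}eqs := psumr_eq0P pr eqs.
  have D0 : D = 0.
    rewrite /D big1 // => i iT; have e := eqs i iT.
    have [->|d0] := posnP (d i); first by rewrite mul0r.
    have [ci|ci] := ltrP (c i) 1.
      by have := @hP' i (d i) ci; rewrite d0 dm // => /(_ isT); move: e; rewrite /w; lra.
    have -> : w i = 0; last by rewrite mulr0.
    by rewrite /w (_ : c i = 1) ?invr1 ?subrr //; apply/eqP; rewrite eq_le ci deficient_le1.
  rewrite D0 mulr0 in hD; have : 0 < (k i0)%:R * (c i0 - 1) by apply: mulr_gt0.
  lra.
have prodS : \prod_(i in S) c i = c i0 by rewrite Si0 big_set1.
rewrite prod_splitS prodS.
have PE : \prod_(i in ~: S) c i = (\prod_(i in ~: S) (1 + w i))^-1.
  by rewrite -prodfV; apply: eq_bigr => i _; rewrite addrC subrK invrK.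
have PW := prod1D_ge w0.
have P0 : 0 < \prod_(i in ~: S) (1 + w i).
  by apply: prodr_gt0 => i _; rewrite addrC subrK invr_gt0.
rewrite PE ltr_pdivrMr // mul1r; apply: lt_le_trans PW; rewrite -/W; lra.
Qed.

(* With two excesses or more, each [k i] is at least the coefficient of the
   logarithmic bound [hQ], and the means inequality suffices. *)
Lemma many_excess : (1 < #|S|)%N -> (0 < n)%N -> \prod_i c i < 1.
Proof.
move=> S1 n0.
have Sn0 : S != set0 by rewrite -card_gt0 ltnW.
pose L i := \sum_(a <- fs i) a.
have [d [dm dh dw]] := excess_allocation L Sn0 n0.
have lt := excess_budget Sn0 n0.
set K := n%:R - \sum_(i in S) (m i)%:R in dw.
have K0 : 0 < K by rewrite /K subr_gt0 -natr_sum ltr_nat.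
have sS : #|S|%:R + #|~: S|%:R = r%:R :> rat by rewrite -natrD cardsC.
have s2 : 2 <= #|S|%:R :> rat by rewrite (ler_nat _ 2).
have r2' : 2 <= r%:R :> rat by rewrite (ler_nat _ 2).
have nr0 : 0 < n%:R / r%:R :> rat by rewrite divr_gt0 ?ltr0n //; apply: ltn_trans r2.
have rp : 0 < r%:R :> rat by lra.
have mle i : n%:R / r%:R <= (m i)%:R :> rat.
  by rewrite ler_pdivrMr // mulrC -natrM ler_nat.
have KT : K <= #|~: S|%:R * (n%:R / r%:R).
  have : \sum_(i in S) n%:R / r%:R <= \sum_(i in S) (m i)%:R :> rat by apply: ler_sum.
  rewrite sum_const_natl.
  have -> : #|~: S|%:R = r%:R - #|S|%:R :> rat by rewrite -sS addrC addKr.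
  have : r%:R * (n%:R / r%:R) = n%:R :> rat by field; lra.
  by rewrite /K; lra.
have t0 : 0 < #|~: S|%:R :> rat.
  by rewrite -(pmulr_lgt0 _ nr0); apply: lt_le_trans KT.
pose t : rat := #|~: S|%:R.
(* The coefficient of [hQ] with d i replaced by the mean share K / t. *)
pose A := K / t * (r%:R - 2) + n%:R / r%:R.
have A0 : 0 < A by rewrite ltr_wpDl // mulr_ge0 ?divr_ge0 //; lra.
(* k i is K plus the m j of the other excesses, each at least n / r. As K / t <= n / r, this covers
   A once there are two excesses. *)
have kA i : i \in S -> A <= (k i)%:R.
  move=> iS.
  have kE : (k i)%:R = K + \sum_(j in S :\ i) (m j)%:R :> rat.
    by rewrite /K (big_setD1 i iS) /= -(km i) natrD; lra.
  have h1 : (#|S|%:R - 1) * (n%:R / r%:R) <= \sum_(j in S :\ i) (m j)%:R :> rat.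
    have eS : #|S|%:R = #|S :\ i|%:R + 1 :> rat by rewrite (cardsD1 i S) iS natrD addrC.
    rewrite eS addrK.
    have : \sum_(j in S :\ i) n%:R / r%:R <= \sum_(j in S :\ i) (m j)%:R :> rat by apply: ler_sum.
    by rewrite sum_const_natl.
  rewrite kE; apply: le_trans (lerD (lexx K) h1); rewrite /A.
  have -> : r%:R - 2 = t + (#|S|%:R - 2) by rewrite /t -sS; ring.
  have -> : K / t * (t + (#|S|%:R - 2)) = K + K / t * (#|S|%:R - 2) by rewrite /t; field; lra.
  have : K / t * (#|S|%:R - 2) <= n%:R / r%:R * (#|S|%:R - 2).
    by apply: ler_wpM2r; [lra|rewrite ler_pdivrMr // mulrC].
  lra.
have L0 i : i \in ~: S -> 0 <= L i.
  move=> iT; rewrite /L big_seq; apply: sumr_ge0 => a.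
  by move=> /(allP (fs1 (deficient_le1 iT))) /andP[].
have eL : \sum_(i in S) (c i - 1) <= \sum_(i in ~: S) L i.
  rewrite -(ler_pM2l A0) mulr_sumr.
  apply: le_trans (_ : \sum_(i in S) (k i)%:R * (c i - 1) <= _).
    apply: ler_sum => i iS; apply: ler_wpM2r; last exact: kA.
    by move: iS; rewrite inE subr_ge0 => /ltW.
  apply: le_trans dh _.
  apply: le_trans (_ : \sum_(i in ~: S) ((r%:R - 2) * ((d i)%:R * L i) + n%:R / r%:R * L i) <= _).
    apply: ler_sum => i iT; apply: le_trans (hQ (deficient_le1 iT) (dm _ iT)) _.
    by rewrite -/(L i) mulrDl mulrA [_ * (r%:R - 2)]mulrC.
  rewrite big_split /= -!mulr_sumr /A.
  move: dw; set X := \sum_(i in ~: S) (d i)%:R * L i; set Y := \sum_(i in ~: S) L i => dw.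
  have XY : X <= K / t * Y by rewrite mulrAC ler_pdivlMr // mulrC.
  have : (r%:R - 2) * X <= (r%:R - 2) * (K / t * Y) by apply: ler_wpM2l => //; lra.
  have -> : (K / t * (r%:R - 2) + n%:R / r%:R) * Y = (r%:R - 2) * (K / t * Y) + n%:R / r%:R * Y by ring.
  by rewrite lerD2r.
(* The excesses enter [prod_1B_lt1] as the negative terms 1 - c i, the other families through their
   factors. *)
pose g i := if i \in S then [:: 1 - c i] else fs i.
pose s := flatten [seq g i | i <- enum I].
have gT i : i \in ~: S -> g i = fs i by rewrite in_setC /g => /negPf->.
have gS i : i \in S -> g i = [:: 1 - c i] by rewrite /g => ->.
have -> : \prod_i c i = \prod_(a <- s) (1 - a).
  rewrite /s big_flatten big_map big_enum /=; apply: eq_bigr => i _.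
  have [iS|iT] := boolP (i \in S); first by rewrite gS // big_seq1 subKr.
  by rewrite gT ?in_setC // fsc // deficient_le1 // in_setC.
apply: prod_1B_lt1.
- apply/allP => a /flattenP[_ /mapP[i _ ->]].
  have [iS|iT] := boolP (i \in S).
    by rewrite gS // mem_seq1 => /eqP->; rewrite gerBl ltW.
  rewrite -in_setC in iT; rewrite gT // => /(allP (fs1 (deficient_le1 iT))) /andP[] //.
- rewrite /s big_flatten big_map big_enum /= sum_splitS.
  have -> : \sum_(i in S) \sum_(a <- g i) a = - \sum_(i in S) (c i - 1).
    by rewrite -sumrN; apply: eq_bigr => i iS; rewrite gS // big_seq1 opprB.
  have -> : \sum_(i in ~: S) \sum_(a <- g i) a = \sum_(i in ~: S) L i.
    by apply: eq_bigr => i iT; rewrite gT.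
  by rewrite addrC subr_ge0.
have [i iS] := set0Pn _ Sn0; apply/hasP; exists (1 - c i).
  by apply/flattenP; exists (g i); [apply/map_f; rewrite mem_enum|rewrite gS // mem_seq1].
by move: iS; rewrite inE subr_lt0.
Qed.

Lemma excess_product : \prod_i c i <= 1 /\ (\prod_i c i = 1 -> forall i, c i = 1).
Proof.
have [S0|Sn0] := eqVneq S set0; first exact: no_excess.
have n0 : (0 < n)%N by have [i _] := set0Pn _ Sn0; rewrite -(km i) addn_gt0 k0.
have lt : \prod_i c i < 1.
  move: (Sn0); rewrite -card_gt0 leq_eqVlt => /orP[/eqP|] c1; first exact: one_excess.
  exact: many_excess.
by split=> [|e]; [apply: ltW|rewrite e ltxx in lt].
Qed.

End Core.

(** * Excess and deficiency of an initial segment *)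

Section WordExcess.
Variables (r n m k : nat) (w : word).
Hypotheses (r2 : (2 <= r)%N) (mr : (n <= r * m)%N) (km : (k + m = n)%N) (k0 : (0 < k)%N).
Hypotheses (V : wvalid w n m) (w0 : 0 < wmu w n m).

Definition wratio : rat := wmu w n m * n%:R / k%:R.
Definition wexcess (d : nat) : rat := n%:R * wmu w n d - (n%:R - d%:R).
(** The first letter of [Wand u] contributes 1 - m/n = k/n, the density of a star, so the factors of
    u alone give [wratio]. Under [Wor] a ratio at most 1 equals 1, the empty product. *)
Definition wtail : seq rat := if w is Wand u then wfactors u n.-1 m else [::].

Let n0 : (0 < n)%N. Proof. by rewrite -km addn_gt0 k0. Qed.
Let m0 : (0 < m)%N. Proof. by case: m mr => // ; rewrite muln0 leqn0 eqn0Ngt n0. Qed.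
Let nn0 : @Order.lt _ rat 0 n%:R. Proof. by rewrite ltr0n. Qed.
Let nk0 : @Order.lt _ rat 0 k%:R. Proof. by rewrite ltr0n. Qed.
Let nm0 : @Order.lt _ rat 0 m%:R. Proof. by rewrite ltr0n. Qed.
Let nkn : k%:R != 0 :> rat. Proof. exact: lt0r_neq0. Qed.
Let nnn : n%:R != 0 :> rat. Proof. exact: lt0r_neq0. Qed.
Let nkm : @eq rat k%:R (n%:R - m%:R). Proof. by rewrite -km natrD addrK. Qed.
Let nmr : @Order.le _ rat n%:R (r%:R * m%:R). Proof. by rewrite -natrM ler_nat. Qed.
Let nr2 : @Order.le _ rat 2 r%:R. Proof. by rewrite (ler_nat _ 2). Qed.

Ltac wlra := move: nn0 nk0 nm0 nkm nmr nr2 => *; lra.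

Lemma wratio_gt0 : 0 < wratio. Proof. by rewrite divr_gt0 // mulr_gt0. Qed.

Lemma wratio_wand u : w = Wand u -> wratio = wmu u n.-1 m.
Proof. rewrite /wratio => -> /=; rewrite nkm; field; rewrite -nkm nkn nnn //. Qed.

Lemma wratio_wall : w = Wall -> 1 < wratio.
Proof. by rewrite /wratio => -> /=; rewrite mul1r ltr_pdivlMr // mul1r nkm; wlra. Qed.

Lemma wexcess_wor u d : w = Wor u -> wexcess d = d%:R * wmu u n.-1 d.-1.
Proof. by rewrite /wexcess => -> /=; field. Qed.

Lemma wexcess_wand u d : w = Wand u -> wexcess d = - ((n%:R - d%:R) * (1 - wmu u n.-1 d)).
Proof. by rewrite /wexcess => -> /=; field. Qed.

Lemma wratio_wor u : w = Wor u -> k%:R * (wratio - 1) = m%:R * wmu u n.-1 m.-1.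
Proof. by rewrite /wratio => -> /=; rewrite nkm; field; rewrite -nkm nkn nnn. Qed.

Lemma wor_valid u : w = Wor u -> wvalid u n.-1 m.-1.
Proof. by move=> e; move: V; rewrite e; case: (m) m0 => //= m' _ /andP[]. Qed.

Lemma wor_le1 u : w = Wor u -> wratio <= 1 -> wratio = 1.
Proof.
move=> e c1; apply/eqP; rewrite eq_le c1 /= -subr_ge0 -(pmulr_rge0 _ nk0) (wratio_wor e).
by rewrite mulr_ge0 //; have /andP[] := wmu_bounds (wor_valid e).
Qed.

Lemma wexcess_wor_ge u d : w = Wor u -> (d <= m)%N -> d%:R * wmu u n.-1 m.-1 <= wexcess d.
Proof.
move=> e dm; rewrite (wexcess_wor _ e) ler_wpM2l // (wmu_le (wor_valid e)) //.
by case: (d) (m) dm => [|?] [|?].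
Qed.

(** For [Wor u], k (c - 1) and the excess at level d are m and d times the densities of u at levels
    m - 1 and d - 1, and lower levels are denser. [Wall] gives equality, and [Wand] has ratio at
    most 1. *)
Lemma wexcess_gt1 d : 1 < wratio -> (d <= m)%N ->
  d%:R * k%:R * (wratio - 1) <= m%:R * wexcess d.
Proof.
case e : w => [||u|u].
- by move: w0; rewrite e ltxx.
- move=> _ _; rewrite /wratio /wexcess e /= nkm.
  by rewrite le_eqVlt; apply/orP; left; apply/eqP; field; rewrite -nkm.
- rewrite (wratio_wand e) ltNge; have := V; rewrite e => /andP[_ Vu].
  by have /andP[_ ->] := wmu_bounds Vu.
move=> _ dm; rewrite -mulrA (wratio_wor e).
have := wexcess_wor_ge e dm; rewrite -(ler_pM2l nm0); wlra.
Qed.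

Lemma wand_facts u : w = Wand u -> [/\ (m < n)%N, wvalid u n.-1 m & 0 < wmu u n.-1 m].
Proof.
move=> e; have := V; rewrite e => /andP[mn Vu]; split=> //.
by rewrite -(wratio_wand e) wratio_gt0.
Qed.

Lemma wmu_eq1 u N d : wvalid u N m -> (d <= m)%N -> wmu u N m = 1 -> wmu u N d = 1.
Proof.
move=> Vu dm e; apply/eqP; rewrite eq_le -{2}e wmu_le // andbT.
by have /andP[] := wmu_bounds (wvalidW dm Vu).
Qed.

Lemma wexcess_le1 d : wratio <= 1 -> (d <= m)%N ->
  - wexcess d <= d%:R * (r%:R - 1) * (wratio^-1 - 1).
Proof.
case e : w => [||u|u].
- by move: w0; rewrite e ltxx.
- by rewrite leNgt wratio_wall.
- rewrite (wratio_wand e) (wexcess_wand _ e) opprK => c1 dm.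
  have [mn Vu u0] := wand_facts e.
  have [d0|d0] := posnP d.
    by rewrite d0 wmu0_gt0 ?subrr ?mulr0 ?mul0r // (lt_le_trans u0) // wmu_le.
  move: c1; rewrite le_eqVlt => /orP[/eqP c1|c1].
    by rewrite (wmu_eq1 Vu dm c1) c1 invr1 subrr !mulr0.
  have Nn : n.-1.+1 = n by rewrite prednK.
  have := @wmu_trade (r%:R - 1) u n.-1 m d _ _ Vu _ u0 c1; rewrite Nn d0 dm => T.
  have {T} : (n%:R - d%:R) * (1 - wmu u n.-1 d) * wmu u n.-1 m < d%:R * (r%:R - 1) * (1 - wmu u n.-1 m).
    by apply: T => //; wlra.
  move=> T; apply/ltW; rewrite -(ltr_pM2r u0); apply: lt_le_trans T _.
  by rewrite -[X in _ <= X]mulrA mulrBl mulVf ?mul1r // lt0r_neq0.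
move=> c1 dm; have := wexcess_wor_ge e dm; rewrite (wor_le1 e c1) invr1 subrr mulr0 => H.
have : 0 <= d%:R * wmu u n.-1 m.-1.
  by rewrite mulr_ge0 //; have /andP[] := wmu_bounds (wor_valid e).
lra.
Qed.

Lemma wexcess_lt1 d : wratio < 1 -> (0 < d <= m)%N ->
  - wexcess d < d%:R * (r%:R - 1) * (wratio^-1 - 1).
Proof.
case e : w => [||u|u].
- by move: w0; rewrite e ltxx.
- by rewrite ltNge ltW // wratio_wall.
- rewrite (wratio_wand e) (wexcess_wand _ e) opprK => c1 ddm.
  have [mn Vu u0] := wand_facts e.
  have Nn : n.-1.+1 = n by rewrite prednK.
  have := @wmu_trade (r%:R - 1) u n.-1 m d _ _ Vu ddm u0 c1; rewrite Nn => T.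
  have {T} : (n%:R - d%:R) * (1 - wmu u n.-1 d) * wmu u n.-1 m < d%:R * (r%:R - 1) * (1 - wmu u n.-1 m).
    by apply: T => //; wlra.
  move=> T; rewrite -(ltr_pM2r u0); apply: lt_le_trans T _.
  by rewrite -[X in _ <= X]mulrA mulrBl mulVf ?mul1r // lt0r_neq0.
by move=> c1; have := wor_le1 e (ltW c1) => e1; rewrite e1 ltxx in c1.
Qed.

Lemma wtail_bounds : wratio <= 1 -> all (fun a => 0 <= a <= 1) wtail.
Proof.
rewrite /wtail => c1; case e : w => [||u|u] //.
by have [_ Vu _] := wand_facts e; apply: wfactors_bounds.
Qed.

Lemma wtail_prod : wratio <= 1 -> \prod_(a <- wtail) (1 - a) = wratio.
Proof.
move=> c1; rewrite /wtail; case e : w => [||u|u].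
- by move: w0; rewrite e ltxx.
- by move: c1; rewrite leNgt wratio_wall.
- by rewrite wfactors_prod (wratio_wand e).
- by rewrite big_nil (wor_le1 e c1).
Qed.

Lemma wexcess_tail d : wratio <= 1 -> (d <= m)%N ->
  - wexcess d <= (d%:R * (r%:R - 2) + n%:R / r%:R) * \sum_(a <- wtail) a.
Proof.
move=> c1 dm; rewrite /wtail; case e : w => [||u|u].
- by move: w0; rewrite e ltxx.
- by move: c1; rewrite leNgt wratio_wall.
- have [mn Vu u0] := wand_facts e; rewrite (wexcess_wand _ e) opprK.
  have Nn : n.-1.+1 = n by rewrite prednK.
  have [d0|d0] := posnP d.
    rewrite d0 wmu0_gt0 ?subrr ?mulr0 ?mul0r ?add0r; last first.
      by rewrite (lt_le_trans u0) // wmu_le.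
    rewrite mulr_ge0 ?divr_ge0 // big_seq; apply: sumr_ge0 => a.
    by move/(allP (wfactors_bounds Vu)) => /andP[].
  have := @wfactors_sum (r%:R - 1) u n.-1 m d _ _ Vu _ u0; rewrite Nn d0 dm subrK.
  have -> : r%:R - 1 - 1 = r%:R - 2 :> rat by ring.
  by apply => //; wlra.
have := wexcess_wor_ge e dm; rewrite big_nil mulr0 => H.
have : 0 <= d%:R * wmu u n.-1 m.-1.
  by rewrite mulr_ge0 //; have /andP[] := wmu_bounds (wor_valid e).
lra.
Qed.

End WordExcess.

Lemma word_product (I : finType) (n : nat) (m k : I -> nat) (w : I -> word) :
  (2 <= #|I|)%N -> (forall i, n <= #|I| * m i)%N -> (forall i, k i + m i = n)%N ->
  (forall i, 0 < k i)%N -> (forall i, wvalid (w i) n (m i)) -> (forall i, 0 < wmu (w i) n (m i)) ->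
  (forall d : I -> nat, (forall i, d i <= m i)%N -> (\sum_i d i = n)%N ->
     \sum_i wmu (w i) n (d i) <= #|I|%:R - 1) ->
  \prod_i wmu (w i) n (m i) <= \prod_i ((k i)%:R / n%:R) /\
  (\prod_i wmu (w i) n (m i) = \prod_i ((k i)%:R / n%:R) ->
     forall i, wmu (w i) n (m i) = (k i)%:R / n%:R).
Proof.
move=> r2 mr km k0 V w0 hs.
have [i0 _] : exists i0 : I, i0 \in I by apply/card_gt0P; apply: ltn_trans r2.
have n0 : (0 < n)%N by rewrite -(km i0) addn_gt0 k0.
have nn : n%:R != 0 :> rat by rewrite pnatr_eq0 -lt0n.
have kn i : (k i)%:R != 0 :> rat by rewrite pnatr_eq0 -lt0n.
have m0 i : (0 < m i)%N by have := mr i; case: (m i) => //; rewrite muln0 leqn0 eqn0Ngt n0.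
pose c i := wratio n (m i) (k i) (w i).
have cE i : wmu (w i) n (m i) = c i * ((k i)%:R / n%:R).
  by rewrite /c /wratio; field; rewrite kn nn.
have P0 : \prod_i ((k i)%:R / n%:R) > 0 :> rat.
  by apply: prodr_gt0 => i _; rewrite divr_gt0 // ltr0n.
have hsum (d : I -> nat) : (forall i, d i <= m i)%N -> (\sum_i d i = n)%N ->
    \sum_i wexcess n (w i) (d i) <= 0.
  move=> dm ds; have le := hs d dm ds.
  have dsR : \sum_i (d i)%:R = n%:R :> rat by rewrite -natr_sum ds.
  rewrite /wexcess !sumrB -mulr_sumr dsR sumr_const -[_ *+ #|I|]mulr_natr.
  have : n%:R * \sum_i wmu (w i) n (d i) <= n%:R * (#|I|%:R - 1) by apply: ler_wpM2l.
  lra.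
have [] := @excess_product I n m k (fun i => wexcess n (w i)) c (fun i => wtail n (m i) (w i)) r2 mr km k0 m0 _ hsum.
- move=> i; exact: wratio_gt0 (km i) (k0 i) (w0 i).
- move=> i; exact: wexcess_gt1 r2 (mr i) (km i) (k0 i) (V i) (w0 i).
- move=> i; exact: wexcess_le1 r2 (mr i) (km i) (k0 i) (V i) (w0 i).
- move=> i; exact: wexcess_lt1 r2 (mr i) (km i) (k0 i) (V i) (w0 i).
- move=> i; exact: wtail_bounds (km i) (k0 i) (V i) (w0 i).
- move=> i; exact: wtail_prod r2 (mr i) (km i) (k0 i) (V i) (w0 i).
- move=> i; exact: wexcess_tail r2 (mr i) (km i) (k0 i) (V i) (w0 i).
move=> le1 eq1; rewrite (eq_bigr _ (fun i _ => cE i)) big_split /=; split.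
  by rewrite ler_piMl // ltW.
move=> e i; rewrite cE eq1 ?mul1r //; apply: (mulIf (lt0r_neq0 P0)).
by rewrite mul1r.
Qed.

(** * Random partitions *)

Local Open Scope nat_scope.

Section Down.
Variable T : finType.
Implicit Types (A B X : {set T}) (G H D : {set {set T}}).

Definition down G d : {set {set T}} :=
  [set B : {set T} | (#|B| == d) && [exists A in G, B \subset A]].

Lemma downP G d B : reflect (#|B| = d /\ exists2 A, A \in G & B \subset A) (B \in down G d).
Proof.
rewrite inE; apply: (iffP andP) => [[/eqP cB /existsP[A /andP[GA BA]]]|[cB [A GA BA]]].
  by split=> //; exists A.
by split; [apply/eqP|apply/existsP; exists A; rewrite GA].
Qed.

Lemma down_uniform G d : down G d \subset uniform_on setT d.
Proof. by apply/subsetP => B /downP[cB _]; rewrite inE subsetT cB /=. Qed.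

Lemma shadow_down G d : shadow (down G d.+1) \subset down G d.
Proof.
apply/subsetP => B /shadowP[y yB /downP[c [A GA sA]]]; apply/downP; split.
  by move: c; rewrite cardsU1 yB => -[].
by exists A => //; apply: subset_trans sA; apply: subsetUr.
Qed.

Lemma kruskal_katona m w G d : G \subset uniform_on setT m -> wvalid w #|T| m ->
  wcard w #|T| m <= #|G| -> d <= m -> wcard w #|T| d <= #|down G d|.
Proof.
move=> sG V leG dm; have {d dm} [e -> em] : exists2 e, d = m - e & e <= m.
  by exists (m - d); lia.
elim: e em => [|e IH] em.
  rewrite subn0; apply: leq_trans leG _; apply/subset_leq_card/subsetP => A GA.
  apply/downP; split; last by exists A.
  by move/subsetP: sG => /(_ A GA); rewrite inE => /andP[_ /eqP].
have eS : m - e = (m - e.+1).+1 by lia.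
have := IH (ltnW em); rewrite eS => {}IH.
apply: leq_trans (subset_leq_card (shadow_down G _)).
rewrite -[in X in X <= _]cardsT; apply: (@kruskal_katona_step _ setT); rewrite ?cardsT //.
- by apply: wvalidW V; lia.
- exact: down_uniform.
Qed.

(** Points of A outside B are exchanged one at a time for points of B outside A. The fixed points
    let [partition_tight] move one block while a disjoint one stays in place. *)
Lemma perm_moves A B : #|A| = #|B| ->
  exists2 s : {perm T}, s @: A = B & forall x, x \notin A :|: B -> s x = x.
Proof.
move eqk: #|A :\: B| => k; elim: k A eqk => [|k IH] A eqk cAB.
  exists 1%g => [|x _]; last by rewrite perm1.
  have sAB : A \subset B by rewrite -setD_eq0 -cards_eq0 eqk.
  rewrite -[RHS](_ : A = B); last by apply/eqP; rewrite eqEcard sAB cAB leqnn.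
  by rewrite (eq_imset (g := id)) ?imset_id // => x; rewrite perm1.
have [a] : exists a, a \in A :\: B by apply/card_gt0P; rewrite eqk.
rewrite inE => /andP[aB aA].
have [b] : exists b, b \in B :\: A.
  apply/card_gt0P; have := cardsID B A; have := cardsID A B; rewrite setIC; lia.
rewrite inE => /andP[bA bB].
have ab : a != b by apply: contraNneq aB => ->.
pose A' := b |: (A :\ a).
have cA' : #|A'| = #|B|.
  rewrite cardsU1 !inE (negPf bA) andbF /= -cAB; have := cardsD1 a A; rewrite aA; lia.
have dA' : #|A' :\: B| = k.
  have -> : A' :\: B = (A :\: B) :\ a.
    apply/setP => z; rewrite !inE; case: (eqVneq z b) => [->|zb]; first by rewrite bB (negPf bA) !andbF.
    by case: (z \in B); rewrite ?andbF.
  by have := cardsD1 a (A :\: B); rewrite eqk !inE aB aA /=; lia.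
have [s sA' sfix] := IH A' dA' cA'.
exists (tperm a b * s)%g.
  rewrite -sA' /A'; apply/setP => z; apply/imsetP/imsetP => -[x].
    move=> xA ->; rewrite permM; exists (tperm a b x) => //.
    case: tpermP => [_|xb|/eqP xa /eqP xb]; rewrite !inE ?eqxx //.
      by rewrite xb (negPf bA) in xA.
    by rewrite xa xA orbT.
  rewrite !inE => /orP[/eqP-> ->|/andP[xa xA] ->].
    by exists a => //; rewrite permM tpermL.
  exists x => //; rewrite permM tpermD //; first by rewrite eq_sym.
  by apply: contraNneq bA => ->.
move=> x; rewrite inE negb_or => /andP[xA xB]; rewrite permM tpermD; last 2 first.
- by apply: contraNneq xA => <-.
- by apply: contraNneq xB => <-.
by apply: sfix; rewrite !inE !negb_or xB andbT negb_and xA orbT andbT; apply: contraNneq xB => ->.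
Qed.

(** By translation in the symmetric group, every set of size [#|A|] is the image of A under equally
    many permutations, and these classes partition the group. *)
Lemma card_perm_to A B : #|A| = #|B| ->
  #|[set s : {perm T} | s @: A == B]| * 'C(#|T|, #|A|) = #|T|`!.
Proof.
move=> cAB.
have const C : C \in uniform_on setT #|A| ->
    #|[set s : {perm T} | s @: A == C]| = #|[set s : {perm T} | s @: A == B]|.
  rewrite inE => /andP[_ /eqP cC].
  have [u uB _] : exists2 s : {perm T}, s @: B = C & forall x, x \notin B :|: C -> s x = x.
    by apply: perm_moves; rewrite cC cAB.
  rewrite -[RHS](card_imset _ (mulIg u)); apply: eq_card => s; rewrite inE; apply/eqP/imsetP.
    move=> sC; exists (s * u^-1)%g; last by rewrite mulgKV.
    rewrite inE -(inj_eq (imset_inj (@perm_inj _ u))) -imset_comp uB -sC.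
    by apply/eqP/eq_imset => x /=; rewrite -permM mulgKV.
  case=> v; rewrite inE => /eqP vB ->; rewrite -uB -vB -imset_comp.
  by apply: eq_imset => x /=; rewrite permM.
rewrite -cardsT -card_uniform_on mulnC -sum_nat_const -(eq_bigr _ const).
rewrite cardsT; have <- : #|{: {perm T}}| = #|T|`!.
  rewrite -cardsT -card_perm; apply: eq_card => s; rewrite [RHS]inE; apply/esym/subsetP => x _.
  by rewrite inE.
rewrite (eq_bigr (fun C => \sum_(s : {perm T} | s @: A == C) 1)); last first.
  by move=> C _; rewrite sum1_card; apply: eq_card => s; rewrite inE.
rewrite -[RHS]sum1_card (exchange_big_dep predT) //=.
apply: eq_bigr => s _; rewrite sum1_card.
rewrite -(cards1 (s @: A)); apply: eq_card => C; rewrite [RHS]inE unfold_in /= eq_sym.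
case: eqP => [->|_]; rewrite ?andbF // andbT inE subsetT /= card_imset ?eqxx //.
exact: perm_inj.
Qed.

End Down.

Local Open Scope ring_scope.

Section Coupling.
Variables (T I : finType) (d : I -> nat) (D : I -> {set {set T}}).
Hypothesis dT : (\sum_i d i = #|T|)%N.
Hypothesis sD : forall i, D i \subset uniform_on setT (d i).
Hypothesis nocover : forall B : I -> {set T}, (forall i, B i \in D i) -> \bigcup_i B i != setT.

Lemma exists_coloring : exists f : T -> I, forall i, #|[set x | f x == i]| = d i.
Proof.
have [T0|[x0 _]] := set_0Vmem [set: T].
  have d0 i : d i = 0%N.
    have := dT; rewrite -cardsT T0 cards0 => /eqP; rewrite sum_nat_eq0 => /forallP /(_ i) /eqP //.
  have F (x : T) : False by have := in_setT x; rewrite T0 inE.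
  exists (fun x => match F x with end) => i; rewrite d0; apply/eqP.
  by rewrite cards_eq0; apply/eqP/setP => x; case: (F x).
(* A list with d i copies of each i, read along an enumeration of T, is the colouring. An empty T is
   treated apart because [nth] needs a default colour. *)
pose s := flatten [seq nseq (d i) i | i <- enum I].
have sz : size s = #|T|.
  rewrite size_flatten /shape -map_comp sumnE big_map big_enum /= -dT.
  by apply: eq_bigr => i _; rewrite size_nseq.
have [i0 _] : exists i0, i0 \in s.
  have : (0 < size s)%N by rewrite sz; apply/card_gt0P; exists x0.
  by case: (s) => // i s' _; exists i; rewrite mem_head.
exists (fun x => nth i0 s (enum_rank x)) => i.
rewrite cardE size_filter -enumT.
have -> : count (fun x => x \in [set x | nth i0 s (enum_rank x) == i]) (enum T) =
    count (pred1 i) [seq nth i0 s (enum_rank x) | x <- enum T].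
  by rewrite count_map; apply: eq_count => x; rewrite inE.
have -> : [seq nth i0 s (enum_rank x) | x <- enum T] = s.
  apply: (@eq_from_nth _ i0); rewrite size_map -cardE // => j jT.
  rewrite (nth_map x0) -?cardE //; congr (nth _ _ _); apply/eqP.
  by rewrite -(nth_uniq x0 _ _ (enum_uniq T)) -?cardE ?nth_enum_rank.
rewrite count_flatten -map_comp sumnE big_map big_enum /= (bigD1 i) //= big1 ?addn0.
  by rewrite count_nseq /= eqxx mul1n.
by move=> j ji; rewrite count_nseq /= (negPf ji).
Qed.

Lemma perm_count f : (forall i, #|[set x | f x == i]| = d i) -> forall i : I,
  #|[set s : {perm T} | s @: [set x | f x == i] \in D i]|%:R
    = #|T|`!%:R * (#|D i|%:R / 'C(#|T|, d i)%:R) :> rat.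
Proof.
move=> fd i; set A := [set x | f x == i].
have cA : #|A| = d i := fd i.
have C0 : 'C(#|T|, d i)%:R != 0 :> rat.
  by rewrite pnatr_eq0 -lt0n bin_gt0 -cA max_card.
apply: (mulIf C0); rewrite -mulrA divfK // -!natrM; congr (_%:R).
have -> : #|[set s : {perm T} | s @: A \in D i]| =
    (\sum_(C in D i) #|[set s : {perm T} | s @: A == C]|)%N.
  rewrite (eq_bigr (fun C => \sum_(s : {perm T} | s @: A == C) 1)%N); last first.
    by move=> C _; rewrite sum1_card; apply: eq_card => s; rewrite inE.
  rewrite (exchange_big_dep predT) //= -sum1_card [LHS]big_mkcond; apply: eq_bigr => s _.
  rewrite inE sum1_card; case: ifP => sA.
    rewrite -(cards1 (s @: A)); apply: eq_card => C; rewrite [LHS]inE unfold_in /= eq_sym.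
    by case: eqP => [<-|_]; rewrite ?andbF // sA.
  rewrite eq_card0 // => C; rewrite unfold_in /= inE.
  by case: eqP => [<-|_]; rewrite ?andbF // sA.
rewrite big_distrl mulnC -sum_nat_const /=; apply: eq_bigr => C CD.
rewrite -cA card_perm_to //.
by move/subsetP: (sD i) => /(_ C CD); rewrite inE cA => /andP[_ /eqP].
Qed.

Lemma perm_fails f (s : {perm T}) : exists i, s @: [set x | f x == i] \notin D i.
Proof.
apply/existsP; rewrite -negb_forall; apply/negP => /forallP all.
have := nocover all; rewrite -subTset => /negP; apply; apply/subsetP => x _.
apply/bigcupP; exists (f (s^-1 x)%g) => //; apply/imsetP; exists (s^-1 x)%g.
  by rewrite inE.
by rewrite permKV.
Qed.

Lemma sum_perm_swap f :
  (\sum_i #|[set s : {perm T} | s @: [set x | f x == i] \in D i]| =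
   \sum_(s : {perm T}) #|[set i | s @: [set x | f x == i] \in D i]|)%N.
Proof.
rewrite (eq_bigr (fun i => \sum_(s : {perm T} | s @: [set x | f x == i] \in D i) 1)%N); last first.
  by move=> i _; rewrite sum1_card; apply: eq_card => s; rewrite inE.
rewrite (exchange_big_dep predT) //=; apply: eq_bigr => s _.
by rewrite sum1_card; apply: eq_card => i; rewrite inE.
Qed.

Lemma card_perm_type : #|{: {perm T}}| = #|T|`!.
Proof.
rewrite -cardsT -card_perm; apply: eq_card => s; rewrite [RHS]inE; apply/esym/subsetP => x _.
by rewrite inE.
Qed.

Lemma perm_hits_lt f (s : {perm T}) : (#|[set i | s @: [set x | f x == i] \in D i]| < #|I|)%N.
Proof.
have [i Hi] := perm_fails f s; rewrite -cardsT; apply: proper_card.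
by apply/properP; split; [apply: subsetT|exists i; rewrite ?inE].
Qed.

(** An average over the permutations of one fixed colouring: the images of its classes cover T, so
    each permutation hits at most [#|I|] - 1 of the families. *)
Lemma partition_bound : \sum_i #|D i|%:R / 'C(#|T|, d i)%:R <= #|I|%:R - 1 :> rat.
Proof.
have [f fd] := exists_coloring.
have F0 : 0 < #|T|`!%:R :> rat by rewrite ltr0n fact_gt0.
rewrite -(ler_pM2l F0) mulr_sumr -(eq_bigr _ (fun i _ => perm_count fd i)).
rewrite -natr_sum sum_perm_swap.
have I0 : (0 < #|I|)%N by have [i _] := perm_fails f 1%g; apply/card_gt0P; exists i.
rewrite -[X in X%:R - 1](prednK I0) -natr1 addrK -natrM ler_nat -card_perm_type -sum_nat_const.
by apply: leq_sum => s _; rewrite -ltnS prednK // perm_hits_lt.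
Qed.

(** If A and B were both missing, a permutation carrying the classes of i and j to them would miss
    two families and push the average strictly below the bound. *)
Lemma partition_tight : \sum_i #|D i|%:R / 'C(#|T|, d i)%:R = #|I|%:R - 1 :> rat ->
  forall (i j : I) (A B : {set T}), i != j -> #|A| = d i -> #|B| = d j -> [disjoint A & B] ->
  (A \in D i) || (B \in D j).
Proof.
move=> eqs i j A B ij cA cB AB; apply: contraT; rewrite negb_or => /andP[nA nB].
have [f fd] := exists_coloring.
have [s1 s1A _] : exists2 s : {perm T}, s @: [set x | f x == i] = A &
    forall x, x \notin [set x | f x == i] :|: A -> s x = x.
  by apply: perm_moves; rewrite fd cA.
set B' := s1 @: [set x | f x == j].
have AB' : [disjoint A & B'].
  rewrite -s1A -setI_eq0 -imsetI; last by move=> x y _ _; apply: perm_inj.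
  rewrite (_ : _ :&: _ = set0) ?imset0 //; apply/setP => x; rewrite !inE.
  by case: eqP => [->|]//=; apply/negbTE.
have [s2 s2B s2fix] : exists2 s : {perm T}, s @: B' = B & forall x, x \notin B' :|: B -> s x = x.
  by apply: perm_moves; rewrite card_imset ?fd ?cB //; apply: perm_inj.
have s2A : s2 @: A = A.
  rewrite -[RHS]imset_id; apply: eq_in_imset => x xA; apply: s2fix.
  by rewrite inE (disjointFr AB' xA) (disjointFr AB xA).
pose s := (s1 * s2)%g.
have sE (X : {set T}) : s @: X = s2 @: (s1 @: X).
  by rewrite -imset_comp; apply: eq_imset => x /=; rewrite permM.
have F0 : 0 < #|T|`!%:R :> rat by rewrite ltr0n fact_gt0.
have I0 : (0 < #|I|)%N by apply/card_gt0P; exists i.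
have : (\sum_(s : {perm T}) #|[set i | s @: [set x | f x == i] \in D i]| < #|T|`! * #|I|.-1)%N.
  rewrite -card_perm_type -sum_nat_const (bigD1 s) //= [X in (_ < X)%N](bigD1 s) //=.
  rewrite -addSn leq_add //.
    have sub : [set i | s @: [set x | f x == i] \in D i] \subset ~: [set i; j].
      apply/subsetP => l; rewrite !inE sE; apply: contraTN => /orP[/eqP->|/eqP->].
        by rewrite s1A s2A.
      by rewrite -/B' s2B.
    have := subset_leq_card sub; have := cardsC [set i; j]; rewrite cards2 ij /=; lia.
  by apply: leq_sum => u _; rewrite -ltnS prednK // perm_hits_lt.
rewrite -sum_perm_swap -(ltr_nat rat) natr_sum (eq_bigr _ (fun i _ => perm_count fd i)).
rewrite -mulr_sumr eqs natrM ltr_pM2l //.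
by rewrite -[X in X%:R - 1](prednK I0) -natr1 addrK ltxx.
Qed.

End Coupling.

(** * Uniqueness of stars *)

Local Open Scope nat_scope.

Section KKUnique.
Variable T : finType.
Implicit Types (A B X Y : {set T}) (G : {set {set T}}).

(** By Kruskal-Katona a family with so small a shadow is smaller than the complete family on one
    point fewer, encoded by [Wand Wall]. Its segment lives on those points, where [wmu_lt] makes the
    shadow strictly denser. *)
Lemma shadow_ratio_lt X m G : G \subset uniform_on X m.+1 -> m.+1 < #|X| -> G != set0 ->
  #|shadow G| < 'C(#|X|.-1, m) -> #|G| * 'C(#|X|.-1, m) < #|shadow G| * 'C(#|X|.-1, m.+1).
Proof.
move=> sG mX G0 ltS; set n := #|X| in mX ltS *.
have ltG : #|G| < 'C(n.-1, m.+1).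
  rewrite ltnNge; apply/negP => leG; move: ltS; apply/negP; rewrite -leqNgt.
  by apply: (@kruskal_katona_step _ X m (Wand Wall)) => //=; rewrite -/n mX /=; lia.
have mn : m.+1 <= n.-1 by lia.
have [u Vu uG] := wvalid_word_exists mn (ltnW ltG).
have le : wcard u n.-1 m <= #|shadow G|.
  by apply: (@kruskal_katona_step _ X m (Wand u)) => //=; rewrite ?uG // -/n mX.
have Cm : 0 < 'C(n.-1, m) by rewrite bin_gt0; lia.
have CM : 0 < 'C(n.-1, m.+1) by rewrite bin_gt0; lia.
apply: leq_trans (leq_mul le (leqnn _)).
rewrite -uG -(ltr_nat rat) !natrM !wcardE ?(wvalidW _ Vu) //.
have CmR : (0 < 'C(n.-1, m)%:R :> rat)%R by rewrite ltr0n.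
have CMR : (0 < 'C(n.-1, m.+1)%:R :> rat)%R by rewrite ltr0n.
rewrite [X in (_ < X)%R]mulrAC !ltr_pM2r //; apply: wmu_lt => //.
apply/andP; split; rewrite -(ltr_pM2r CMR) -wcardE // uG ?mul1r ?ltr_nat //.
by rewrite mul0r ltr0n card_gt0.
Qed.

Lemma sum_card_link G M : G \subset uniform_on setT M -> \sum_v #|link v G| = M * #|G|.
Proof.
move=> /subsetP sG; rewrite mulnC -sum_nat_const.
rewrite (eq_bigr (fun v => \sum_(A in G | v \in A) 1)); last first.
  by move=> v _; rewrite card_link sum1_card; apply: eq_card => A; rewrite inE.
rewrite (exchange_big_dep (fun A => A \in G)) //=; last by move=> v A _ /andP[].
apply: eq_bigr => A GA; rewrite GA sum1_card.
by move: (sG A GA); rewrite inE => /andP[_ /eqP].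
Qed.

(* For each v compare the degree of v in G with its degree in the shadow: their
   ratio is at most that of a complete family on n - 1 points, strictly if
   the degree in the shadow is neither 0 nor that of a complete family.  The
   degree sums force equality for every v, and then some degree is 0. *)
Lemma shadow_star G M : 0 < M < #|T| -> G \subset uniform_on setT M ->
  #|G| = 'C(#|T|.-1, M) -> #|shadow G| <= 'C(#|T|.-1, M.-1) ->
  exists x, forall A, A \in G -> x \notin A.
Proof.
set n := #|T|; case: M => [|[|M]] // /andP[_ Mn] sG cG /= cS.
  (* For M = 1 the shadow carries no degrees; G consists of singletons, and its size leaves one
     out. *)
  have : ~~ ([set [set x] | x in T] \subset G).
    apply/negP => /subset_leq_card; rewrite cG card_imset; last exact: set1_inj.
    by rewrite bin1 -/n; lia.
  case/subsetPn => _ /imsetP[x _ ->] nGx; exists x => A GA.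
  have /cards1P[y eA] : #|A| == 1 by move/subsetP: sG => /(_ A GA); rewrite inE => /andP[].
  by rewrite eA inE; apply: contraNneq nGx => ->; rewrite -eA.
(* b and a are the degrees of a point in the complete family on n - 1 points and in its shadow. *)
set a := 'C(n.-2, M); set b := 'C(n.-2, M.+1).
have ab : 'C(n.-1, M.+1) = b + a by rewrite /a /b -(@prednK n.-1) ?binS //; lia.
have a0 : 0 < a by rewrite bin_gt0; lia.
have b0 : 0 < b by rewrite bin_gt0; lia.
set S := shadow G in cS *.
have sS : S \subset uniform_on setT M.+1 := shadow_uniform sG.
pose f v := #|link v G|; pose g v := #|link v S|.
have key v : f v * a <= g v * b /\ (0 < g v -> g v != a -> f v * a < g v * b).
  have cX : #|setT :\ v| = n.-1 by have := cardsD1 v setT; rewrite in_setT cardsT -/n; lia.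
  have fg : f v + g v <= b + a.
    rewrite -ab; apply: leq_trans cS; rewrite addnC -(card_link_avoid v S) leq_add2l.
    exact: subset_leq_card (link_sub_shadow v G).
  have fs : #|shadow (link v G)| <= g v := subset_leq_card (shadow_link v G).
  have [ag|ga] := leqP a (g v).
    have h : f v * a <= b * g v by apply: leq_mul; [lia|].
    split=> [|_ ne]; first by rewrite [g v * b]mulnC.
    have fb : f v < b by move/eqP: ne; lia.
    apply: leq_trans (_ : b * a <= _); first by rewrite ltn_pmul2r.
    by rewrite mulnC leq_mul2r ag orbT.
  have [f0|f0] := posnP (f v).
    by rewrite f0 mul0n; split=> // g0 _; rewrite muln_gt0 g0.
  have G0 : link v G != set0 by rewrite -card_gt0.
  have mX : M.+1 < n.-1 by lia.
  have := @shadow_ratio_lt (setT :\ v) M (link v G) (link_uniform v sG).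
  rewrite cX -/a -/b => /(_ mX G0 (leq_ltn_trans fs ga)) lt.
  have {}lt : f v * a < g v * b by apply: leq_trans lt _; rewrite leq_mul2r fs orbT.
  by split=> [|_ _] //; apply: ltnW.
have n0 : 0 < n.-1 by lia.
have fsum : \sum_v f v * a = n.-1 * b * a.
  by rewrite -big_distrl /= (sum_card_link sG) cG -(mul_bin_diag n.-1).
have gsum : \sum_v g v <= n.-1 * a.
  rewrite (sum_card_link sS) (mul_bin_diag n.-1) /=.
  by rewrite leq_mul2l cS orbT.
have [v gv0] : exists v, g v = 0.
  suff /existsP[v /eqP gv] : [exists v, g v == 0] by exists v.
  rewrite -[X in is_true X]negbK negb_exists; apply/negP => /forallP gpos.
  have g0 v : 0 < g v by rewrite lt0n.
  have ga v : g v = a.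
    apply/eqP; apply: contraT => ne.
    have : \sum_v f v * a < \sum_v g v * b.
      rewrite (bigD1 v) //= [X in _ < X](bigD1 v) //= -addSn leq_add //.
        exact: (key v).2 (g0 v) ne.
      by apply: leq_sum => u _; apply: (key u).1.
    rewrite fsum -big_distrl /= ltnNge => /negP[].
    by rewrite mulnAC leq_mul2r gsum orbT.
  move: gsum; rewrite (eq_bigr _ (fun v _ => ga v)) sum_nat_const leq_mul2r -/n.
  by rewrite (gtn_eqF a0) /=; lia.
(* Degree 0 in the shadow keeps v out of G: a member through v has a further point y, and removing y
   leaves a shadow set through v. *)
exists v => A GA; apply/negP => vA.
have cA : #|A| = M.+2 by move/subsetP: sG => /(_ A GA); rewrite inE => /andP[_ /eqP].
have [y] : exists y, y \in A :\ v.
  by apply/card_gt0P; have := cardsD1 v A; rewrite vA cA; lia.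
rewrite !inE => /andP[yv yA].
have : A :\ y :\ v \in link v S.
  rewrite inE !inE eqxx /= setD1K ?inE ?vA ?andbT 1?eq_sym //.
  by apply/existsP; exists y; rewrite setD1K // GA !inE eqxx.
have /eqP : #|link v S| = 0 := gv0.
by rewrite cards_eq0 => /eqP ->; rewrite inE.
Qed.

Lemma star_complement G m x : #|G| = 'C(#|T|.-1, m) -> G \subset uniform_on setT m ->
  (forall A, A \in G -> x \notin A) -> G = uniform_on (setT :\ x) m.
Proof.
move=> cG /subsetP sG Gx; apply/eqP; rewrite eqEcard card_uniform_on.
have -> : #|setT :\ x| = #|T|.-1 by have := cardsD1 x setT; rewrite in_setT cardsT; lia.
rewrite cG leqnn andbT; apply/subsetP => A GA.
by move: (sG A GA) (Gx A GA); rewrite !inE subsetD1 => /andP[-> ->] ->.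
Qed.

Lemma exists_between X Y k : X \subset Y -> #|X| <= k <= #|Y| ->
  exists Z : {set T}, [/\ X \subset Z, Z \subset Y & #|Z| = k].
Proof.
move=> XY /andP[Xk kY]; rewrite -(subnKC Xk) in kY *.
elim: (k - #|X|) kY => [|e IH] kY; first by exists X; rewrite addn0.
have [|Z [XZ ZY cZ]] := IH; first by lia.
have [y yY yZ] : exists2 y, y \in Y & y \notin Z.
  by apply/subsetPn; apply: contraL kY => /subset_leq_card; rewrite cZ; lia.
exists (y |: Z); split.
- by apply: subset_trans XZ _; apply: subsetUr.
- by rewrite subUset sub1set yY.
- by rewrite cardsU1 yZ cZ; lia.
Qed.

End KKUnique.

(** * Families whose members cannot cover the ground set *)

Section Cover.
Variables (T I : finType) (m : I -> nat) (G : I -> {set {set T}}).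
Local Notation n := #|T|.
Hypothesis sG : forall i, G i \subset uniform_on setT (m i).
Hypothesis nocover : forall B : I -> {set T}, (forall i, B i \in G i) -> \bigcup_i B i != setT.

Lemma nocover_down d (B : I -> {set T}) :
  (forall i, B i \in down (G i) (d i)) -> \bigcup_i B i != setT.
Proof.
move=> BD; have [A AP] : exists A : I -> {set T}, forall i, A i \in G i /\ B i \subset A i.
  apply: (@fin_all_exists _ _ (fun i X => X \in G i /\ B i \subset X)) => i.
  by have /downP[_ [A GA BA]] := BD i; exists A.
have := nocover (fun i => (AP i).1); apply: contraNneq => e; rewrite -subTset -e.
by apply/bigcupsP => i _; apply: subset_trans (AP i).2 (bigcup_sup _ _).
Qed.

Lemma cover_product (k : I -> nat) : 2 <= #|I| -> (forall i, n <= #|I| * m i) ->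
  (forall i, k i + m i = n) -> (forall i, 0 < k i) -> (forall i, G i != set0) ->
  (\prod_i (#|G i|%:R / 'C(n, m i)%:R) <= \prod_i ((k i)%:R / n%:R) :> rat)%R /\
  ((\prod_i (#|G i|%:R / 'C(n, m i)%:R) = \prod_i ((k i)%:R / n%:R) :> rat)%R ->
   forall i, #|G i| = 'C(n.-1, m i)).
Proof.
move=> r2 mr km k0 G0.
have mn i : m i <= n by rewrite -(km i) leq_addl.
have [w wP] : exists w : I -> word, forall i, wvalid (w i) n (m i) /\ wcard (w i) n (m i) = #|G i|.
  apply: (@fin_all_exists _ _ (fun i u => wvalid u n (m i) /\ wcard u n (m i) = #|G i|)) => i.
  have [|u Vu cu] := @wvalid_word_exists n (m i) #|G i| (mn i); last by exists u.
  by rewrite -cardsT -card_uniform_on subset_leq_card.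
have C0 i d : d <= m i -> (0 < 'C(n, d)%:R :> rat)%R.
  by move=> dm; rewrite ltr0n bin_gt0 (leq_trans dm).
have muE i : (#|G i|%:R / 'C(n, m i)%:R = wmu (w i) n (m i) :> rat)%R.
  have [V c] := wP i; rewrite -c wcardE // mulfK // lt0r_neq0 //.
  exact: C0 (leqnn _).
have hs (d : I -> nat) : (forall i, d i <= m i) -> \sum_i d i = n ->
    (\sum_i wmu (w i) n (d i) <= #|I|%:R - 1 :> rat)%R.
  move=> dm ds; have := @partition_bound T I d (fun i => down (G i) (d i)) ds
     (fun i => down_uniform _ _) (@nocover_down d).
  apply: le_trans; apply: ler_sum => i _; rewrite ler_pdivlMr ?(C0 _ _ (dm i)) //.
  have [V c] := wP i; rewrite -wcardE; last exact: wvalidW V.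
  by rewrite ler_nat (kruskal_katona (sG i) V _ (dm i)) // c.
have w0 i : (0 < wmu (w i) n (m i))%R.
  by rewrite -muE; apply: divr_gt0; [rewrite ltr0n card_gt0|apply: C0 (leqnn _)].
have [le eq] := word_product r2 mr km k0 (fun i => (wP i).1) w0 hs.
rewrite (eq_bigr _ (fun i _ => muE i)); split=> // e i.
have := eq e i; rewrite -muE => E.
have n0 : 0 < n by rewrite -(km i) addn_gt0 k0.
have nR : (n%:R != 0 :> rat)%R by rewrite pnatr_eq0 -lt0n.
have CR := lt0r_neq0 (C0 i _ (leqnn _)).
have E2 : (#|G i|%:R * n%:R = (k i)%:R * 'C(n, m i)%:R :> rat)%R.
  by rewrite mulrC -[(#|G i|%:R)%R](divfK CR) E; field.
apply/eqP; rewrite -(eqn_pmul2l n0) mul_bin_down -(km i) addnK km.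
by rewrite -(eqr_nat rat) !natrM mulrC E2.
Qed.

Section Star.
Hypothesis m0 : forall i, 0 < m i < n.
Hypothesis cG : forall i, #|G i| = 'C(n.-1, m i).

Lemma down_ge i d : d <= m i -> 'C(n.-1, d) <= #|down (G i) d|.
Proof.
have /andP[mi0 mi] := m0 i.
move=> dm; apply: (@kruskal_katona _ (m i) (Wand Wall)) (sG i) _ _ dm => /=; last by rewrite cG.
by rewrite mi /= -ltnS prednK // (leq_trans mi0 (ltnW mi)).
Qed.

(** The densities 1 - d i / n of the lower bound [down_ge] already sum to [#|I|] - 1, which is the
    upper bound [partition_bound]. *)
Lemma down_tight d : (forall i, d i <= m i) -> \sum_i d i = n ->
  (forall i, #|down (G i) (d i)| = 'C(n.-1, d i)) /\
  (\sum_i #|down (G i) (d i)|%:R / 'C(n, d i)%:R = #|I|%:R - 1 :> rat)%R.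
Proof.
move=> dm ds.
have n0 (i : I) : 0 < n by have /andP[_] := m0 i; apply: leq_trans.
have dn i : d i <= n by apply: leq_trans (dm i) _; have /andP[_ /ltnW] := m0 i.
have le := @partition_bound T I d (fun i => down (G i) (d i)) ds
     (fun i => down_uniform _ _) (@nocover_down d).
have C0 i : (0 < 'C(n, d i)%:R :> rat)%R.
  by rewrite ltr0n bin_gt0.
have nR (i : I) : (n%:R != 0 :> rat)%R by rewrite pnatr_eq0 -lt0n (n0 i).
have bE i : ('C(n.-1, d i)%:R / 'C(n, d i)%:R = 1 - (d i)%:R / n%:R :> rat)%R.
  apply: (mulIf (lt0r_neq0 (C0 i))); rewrite divfK ?lt0r_neq0 //.
  apply: (mulfI (nR i)); rewrite -natrM mul_bin_down natrM natrB //.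
  by field; apply: nR i.
have [I0|[i0 _]] := set_0Vmem [set: I].
  split=> [i|]; first by have := in_setT i; rewrite I0 inE.
  apply/eqP; rewrite eq_le le /=.
  have -> : #|I| = 0 by rewrite -cardsT I0 cards0.
  by apply: le_trans (_ : 0 <= _)%R; [by rewrite sub0r oppr_le0|apply: sumr_ge0 => i _; rewrite divr_ge0].
have sE : (\sum_i 'C(n.-1, d i)%:R / 'C(n, d i)%:R = #|I|%:R - 1 :> rat)%R.
  rewrite (eq_bigr _ (fun i _ => bE i)) sumrB -mulr_suml -natr_sum ds divff ?(nR i0) //.
  by rewrite sumr_const.
have le_i i : ('C(n.-1, d i)%:R / 'C(n, d i)%:R <= #|down (G i) (d i)|%:R / 'C(n, d i)%:R :> rat)%R.
  by rewrite ler_pM2r ?invr_gt0 // ler_nat down_ge.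
have eqs : (\sum_i #|down (G i) (d i)|%:R / 'C(n, d i)%:R = #|I|%:R - 1 :> rat)%R.
  by apply/eqP; rewrite eq_le le -sE ler_sum.
split=> // i.
have z : (\sum_i (#|down (G i) (d i)|%:R / 'C(n, d i)%:R - 'C(n.-1, d i)%:R / 'C(n, d i)%:R) = 0 :> rat)%R.
  by rewrite sumrB eqs sE subrr.
have z0 j : true -> (0 <= #|down (G j) (d j)|%:R / 'C(n, d j)%:R - 'C(n.-1, d j)%:R / 'C(n, d j)%:R :> rat)%R.
  by rewrite subr_ge0.
have E := psumr_eq0P z0 z (erefl true : i \in predT).
apply/eqP; rewrite -(eqr_nat rat); apply/eqP/(mulIf (invr_neq0 (lt0r_neq0 (C0 i))))/eqP.
by rewrite -subr_eq0; apply/eqP.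
Qed.

(** As the m j exceed n in total, the level of i can be taken one below m i; tightness there bounds
    the shadow of [G i] as [shadow_star] requires. *)
Lemma avoid_point i : n < \sum_j m j -> exists x, forall A, A \in G i -> x \notin A.
Proof.
move=> lt; have /andP[mi0 mi] := m0 i.
pose a j := if j == i then (m i).-1 else 0.
pose b j := if j == i then (m i).-1 else m j.
have sa : \sum_j a j = (m i).-1.
  by rewrite (bigD1 i) //= /a eqxx big1 ?addn0 // => j /negPf->.
have sb : (\sum_j b j).+1 = \sum_j m j.
  rewrite (bigD1 i) //= [RHS](bigD1 i) //= /b eqxx -addSn prednK //; congr (_ + _).
  by apply: eq_bigr => j /negPf->.
have [||d dP ds] := @extend_sum I a b n.
- by move=> j; rewrite /a /b; case: eqP.
- rewrite sa; apply/andP; split; last by rewrite -ltnS sb.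
  exact: leq_trans (leq_pred _) (ltnW mi).
have dm j : d j <= m j.
  have /andP[_ h] := dP j; apply: leq_trans h _; rewrite /b; case: eqP => // ->; exact: leq_pred.
have di : d i = (m i).-1.
  by apply/eqP; have := dP i; rewrite /a /b eqxx eqn_leq andbC.
have [cD _] := down_tight dm ds.
apply: (@shadow_star T (G i) (m i)) => //; rewrite -di -cD di.
apply/subset_leq_card/subsetP => B /shadowP[y yB GB]; apply/downP; split.
  move/subsetP: (sG i) => /(_ _ GB); rewrite inE cardsU1 yB => /andP[_ /eqP <-] //.
by exists (y |: B); rewrite ?subsetUr.
Qed.

End Star.
End Cover.

(** * Passage between a family and its complements *)

Section Complement.
Variable T : finType.
Implicit Types (A B : {set T}) (F : {set {set T}}).
Local Notation n := #|T|.

Definition cofamily F : {set {set T}} := [set A | ~: A \in F].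

Lemma card_cofamily F : #|cofamily F| = #|F|.
Proof.
rewrite -(card_imset _ (inv_inj (@setCK T))); apply: eq_card => A.
apply/imsetP/idP => [[B FB ->]|FA]; first by move: FB; rewrite inE.
by exists (~: A); rewrite ?inE setCK.
Qed.

Lemma cofamily_uniform F k : F \subset uniform_on setT k ->
  cofamily F \subset uniform_on setT (n - k).
Proof.
move=> /subsetP sF; apply/subsetP => A; rewrite inE => /sF.
by rewrite !inE !subsetT /= => /eqP <-; rewrite -(cardsC A) addnK.
Qed.

Lemma bin_star k : 0 < k <= n -> 'C(n.-1, k.-1) = 'C(n.-1, n - k).
Proof.
move=> /andP[k0 kn]; rewrite -bin_sub; last by rewrite -ltnS !prednK // (leq_trans k0).
by congr 'C(_, _); case: k k0 kn => // k _; case: #|T| => //= N; rewrite subSS.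
Qed.

Definition is_star F k x := forall A, #|A| = k -> (A \in F) = (x \in A).

Lemma cofamily_star F k x : 0 < k <= n -> #|F| = 'C(n.-1, k.-1) -> F \subset uniform_on setT k ->
  (forall A, A \in cofamily F -> x \notin A) -> is_star F k x.
Proof.
move=> kn cF sF Fx A cA; have /andP[k0 kn'] := kn.
have E : cofamily F = uniform_on (setT :\ x) (n - k).
  apply: star_complement Fx; last exact: cofamily_uniform.
  by rewrite card_cofamily cF bin_star.
have <- : (~: A \in cofamily F) = (A \in F) by rewrite inE setCK.
by rewrite E !inE subsetD1 subsetT inE negbK -cA -(cardsC A) addKn eqxx andbT.
Qed.

Lemma pair_star F1 F2 k1 k2 : 0 < k1 -> 0 < k2 -> k1 + k2 < n ->
  F1 \subset uniform_on setT k1 -> F2 \subset uniform_on setT k2 ->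
  #|F1| = 'C(n.-1, k1.-1) -> #|F2| = 'C(n.-1, k2.-1) ->
  (forall A B, A \in F1 -> B \in F2 -> ~~ [disjoint A & B]) ->
  exists x, is_star F1 k1 x /\ is_star F2 k2 x.
Proof.
move=> k10 k20 kn s1 s2 c1 c2 cross.
have k1n : 0 < k1 <= n by rewrite k10; lia.
have k2n : 0 < k2 <= n by rewrite k20; lia.
pose k (b : bool) := if b then k1 else k2.
pose F (b : bool) := if b then F1 else F2.
pose m b := n - k b; pose G b := cofamily (F b).
have sG b : G b \subset uniform_on setT (m b) by apply: cofamily_uniform; case: b.
have nocover (B : bool -> {set T}) : (forall b, B b \in G b) -> \bigcup_b B b != setT.
  move=> BG; apply/eqP => e; have := BG true; have := BG false; rewrite !inE /= => h2 h1.
  move: (cross _ _ h1 h2); rewrite -setI_eq0 -setCU -(inj_eq (inv_inj (@setCK T))) setCK setC0.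
  by rewrite -e (bigD1 true) //= (bigD1 false) //= big_pred0 ?setU0 ?eqxx // => -[].
have m0 b : 0 < m b < n by rewrite /m /k; case: b; lia.
have cG b : #|G b| = 'C(n.-1, m b).
  by rewrite card_cofamily /m /F /k; case: b; rewrite ?c1 ?c2 bin_star.
(* This is where k1 + k2 < n enters: the complementary sizes exceed n in total, as [avoid_point]
   requires. *)
have ms : n < \sum_b m b.
  rewrite (bigD1 true) //= (bigD1 false) //= big_pred0; last by case.
  have h N : k1 + k2 < N -> N < N - k1 + (N - k2) by clear; lia.
  by rewrite addn0; apply: h.
have [x hx] := avoid_point sG nocover m0 cG true ms.
have [y hy] := avoid_point sG nocover m0 cG false ms.
have st1 := cofamily_star k1n c1 s1 hx; have st2 := cofamily_star k2n c2 s2 hy.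
have [exy|xy] := eqVneq x y; first by subst y; exists x.
(* Distinct centres x and y would allow disjoint members: A through x avoiding y, and B through y
   inside the complement of A. *)
have cy (z : T) : #|~: [set z]| = n.-1 by rewrite cardsC1.
have [||A [xA Ay cA]] := @exists_between T [set x] (~: [set y]) k1.
- by rewrite sub1set !inE.
- by rewrite cards1 cy; lia.
have yA : y \notin A by have := subsetP Ay y; rewrite !inE eqxx => h; apply/negP => /h.
have [||B [yB BA cB]] := @exists_between T [set y] (~: A) k2.
- by rewrite sub1set inE.
- by rewrite cards1; have := cardsC A; lia.
have hA : A \in F1 by rewrite st1 // -sub1set.
have hB : B \in F2 by rewrite st2 // -sub1set.
by have := cross _ _ hA hB; rewrite disjoint_sym disjoints_subset BA.
Qed.
End Complement.

(** * Any number of cross-intersecting families *)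

Section Main.
Variables (T I : finType) (k : I -> nat) (F : I -> {set {set T}}).
Local Notation n := #|T|.
Hypothesis sF : forall i, F i \subset uniform_on setT (k i).
Hypothesis k0 : forall i, 0 < k i.
Hypothesis kr : forall i, #|I| * k i <= #|I|.-1 * n.
Hypothesis r2 : 1 < #|I|.
Hypothesis cross : forall A : I -> {set T}, (forall i, A i \in F i) -> \bigcap_i A i != set0.

Let m i := n - k i.
Let G i := cofamily (F i).

Lemma cofamily_nocover (B : I -> {set T}) : (forall i, B i \in G i) -> \bigcup_i B i != setT.
Proof.
move=> BG; have /cross : forall i, ~: B i \in F i by move=> i; have := BG i; rewrite inE.
by rewrite -setC_bigcup -(inj_eq (inv_inj (@setCK T))) setCK setC0.
Qed.

Lemma k_lt_n i : k i < n.
Proof.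
have [n0|n0] := posnP n; first by have := kr i; have := k0 i; rewrite n0; nia.
have := kr i; have h : #|I|.-1 * n < #|I| * n by rewrite ltn_mul2r n0; lia.
by move=> le; rewrite -(@ltn_pmul2l #|I|); [apply: leq_ltn_trans le h|lia].
Qed.

Lemma nm_le i : n <= #|I| * m i.
Proof.
rewrite mulnBr; have := kr i; have -> : #|I| * n = #|I|.-1 * n + n by rewrite -mulSnr prednK //; lia.
by lia.
Qed.

Lemma cross_product : (forall i, F i != set0) ->
  (\prod_i (#|F i|%:R / 'C(n, k i)%:R) <= \prod_i ((k i)%:R / n%:R) :> rat)%R /\
  ((\prod_i (#|F i|%:R / 'C(n, k i)%:R) = \prod_i ((k i)%:R / n%:R) :> rat)%R ->
   forall i, #|F i| = 'C(n.-1, (k i).-1)).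
Proof.
move=> F0; have kn i := k_lt_n i.
have sG i : G i \subset uniform_on setT (m i) by apply: cofamily_uniform.
have km i : k i + m i = n by rewrite subnKC // ltnW.
have G0 i : G i != set0 by rewrite -card_gt0 card_cofamily card_gt0.
have [le eq] := cover_product sG cofamily_nocover r2 nm_le km k0 G0.
have E i : (#|F i|%:R / 'C(n, k i)%:R = #|G i|%:R / 'C(n, m i)%:R :> rat)%R.
  by rewrite card_cofamily /m bin_sub // ltnW.
rewrite (eq_bigr _ (fun i _ => E i)); split=> // e i.
by rewrite -card_cofamily eq // bin_star // k0 ltnW.
Qed.

Hypothesis r3 : 2 < #|I|.
Hypothesis cF : forall i, #|F i| = 'C(n.-1, (k i).-1).

(** A third index l of positive level makes d i + d j < n, so [pair_star] applies to the sets
    outside the shadows of [G i] and [G j]. The centre x passes to [F i] and [F j]: a member of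
    [G b] through x would put a set of size d b through x into the shadow. *)
Lemma pair_center i j : 2 < n -> i != j -> exists x, is_star (F i) (k i) x /\ is_star (F j) (k j) x.
Proof.
move=> n3 ij.
have kn a := k_lt_n a.
have m0 a : 0 < m a < n by have := kn a; have := k0 a; rewrite /m; lia.
have sG a : G a \subset uniform_on setT (m a) by apply: cofamily_uniform.
have kna a : 0 < k a <= n by rewrite k0 ltnW.
have cG a : #|G a| = 'C(n.-1, m a) by rewrite card_cofamily cF bin_star.
have [l lij] : exists l, l \notin [set i; j].
  apply/existsP; rewrite -negb_forall; apply/negP => /forallP all.
  have : #|[set: I]| <= #|[set i; j]| by apply/subset_leq_card/subsetP => a _; apply: all.
  by rewrite cardsT cards2 ij leqNgt r3.
have ms : n <= \sum_a m a.
  rewrite -(@leq_pmul2l #|I|); last by lia.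
  rewrite big_distrr /= -sum_nat_const; apply: leq_sum => a _; exact: nm_le.
(* Level at least 1 at i, j and l; this is possible because n >= 3. *)
pose a b : nat := b \in l |: [set i; j].
have sa : \sum_b a b = 3.
  by rewrite -big_mkcond sum1_card cardsU1 lij cards2 ij.
have [||d dP ds] := @extend_sum I a m n.
- by move=> b; rewrite /a; case: (_ \in _) => //; have /andP[] := m0 b.
- by rewrite sa n3 ms.
have dm b : d b <= m b by have /andP[] := dP b.
have d1 b : b \in l |: [set i; j] -> 0 < d b by have := dP b; rewrite /a => /andP[h _] e; move: h; rewrite e.
have di := d1 i; have dj := d1 j; have dl := d1 l.
rewrite !inE !eqxx ?orbT in di dj dl; have {}di := di isT; have {}dj := dj isT; have {}dl := dl isT.
have dij : d i + d j < n.
  move: lij; rewrite !inE negb_or => /andP[li lj].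
  rewrite -ds (bigD1 i) //= (bigD1 j) ?(eq_sym j) //= (bigD1 l) ?li //= addnA.
  by rewrite -[X in X < _]addn0 ltn_add2l; apply: leq_trans dl (leq_addr _ _).
have [cD tight] := down_tight sG cofamily_nocover m0 cG dm ds.
pose H b := uniform_on setT (d b) :\: down (G b) (d b).
have sH b : H b \subset uniform_on setT (d b) by apply: subsetDl.
have cH b : 0 < d b -> #|H b| = 'C(n.-1, (d b).-1).
  move=> d0; rewrite cardsD (setIidPr (down_uniform _ _)) cD card_uniform_on cardsT.
  rewrite -{1}(prednK (ltnW (ltnW n3))) -{1 2}(prednK d0) binS addKn //.
have crossH A B : A \in H i -> B \in H j -> ~~ [disjoint A & B].
  rewrite /H ![_ \in _ :\: _]in_setD => /andP[nA uA] /andP[nB uB].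
  have cA : #|A| = d i by move: uA; rewrite inE => /andP[_ /eqP].
  have cB : #|B| = d j by move: uB; rewrite inE => /andP[_ /eqP].
  apply/negP => AB; have := partition_tight ds (fun b => down_uniform _ _) (nocover_down cofamily_nocover (d := d)) tight ij cA cB AB.
  by rewrite (negPf nA) (negPf nB).
have [x [sti stj]] := pair_star di dj dij (sH i) (sH j) (cH i di) (cH j dj) crossH.
have center b : 0 < d b -> is_star (H b) (d b) x -> is_star (F b) (k b) x.
  move=> d0 st; apply: cofamily_star => // A GA; apply/negP => xA.
  have cA : #|A| = m b by move/subsetP: (sG b) => /(_ A GA); rewrite inE => /andP[_ /eqP].
  have [||B [xB BA cB]] := @exists_between T [set x] A (d b).
  - by rewrite sub1set.
  - by rewrite cards1 d0 cA dm.
  have := st B cB; rewrite -sub1set xB !inE => /andP[/negP[]].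
  by rewrite cB eqxx; apply/existsP; exists A; rewrite GA.
by exists x; split; apply: center.
Qed.

Lemma star_center_inj (F' : {set {set T}}) k' x y : 0 < k' < n ->
  is_star F' k' x -> is_star F' k' y -> x = y.
Proof.
move=> k'n sx sy; apply/eqP; apply: contraT => xy.
have [||A [xA Ay cA]] := @exists_between T [set x] (~: [set y]) k'.
- by rewrite sub1set !inE.
- by rewrite cards1 cardsC1; lia.
have := sx A cA; rewrite sy // -sub1set -[RHS]sub1set xA sub1set => yA.
by have := subsetP Ay y yA; rewrite !inE eqxx.
Qed.

Lemma cross_star : exists x, forall i, is_star (F i) (k i) x.
Proof.
have kn a := k_lt_n a.
have [i0 _] : exists i0 : I, i0 \in I by apply/card_gt0P; apply: leq_trans r3.
have [n3|n3] := ltnP 2 n.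
  have [j0 j0i] : exists j0, j0 != i0.
    suff /card_gt0P[j] : 0 < #|[set~ i0]| by rewrite !inE => ji; exists j.
    by rewrite cardsC1; lia.
  have [|x [sx _]] := @pair_center i0 j0 n3; first by rewrite eq_sym.
  exists x => j; have [->|ji] := eqVneq j i0 => //.
  have [|y [sy syj]] := @pair_center i0 j n3; first by rewrite eq_sym.
  by rewrite (star_center_inj _ sx sy) // k0 kn.
(* On two points every k i is 1 and each [F i] has a singleton as its only member;
   cross-intersection makes these agree. *)
have n2 : n = 2 by apply/eqP; rewrite eqn_leq n3 (leq_ltn_trans (k0 i0) (kn i0)).
have k1 i : k i = 1 by apply/eqP; rewrite eqn_leq k0 andbT -ltnS -n2 kn.
have F1 i : exists A, F i = [set A].
  by apply/cards1P; rewrite cF k1 bin0.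
have [A FA] := fin_all_exists F1.
have /set0Pn[x /bigcapP xA] : \bigcap_i A i != set0 by apply: cross => i; rewrite FA set11.
exists x => i B cB; rewrite FA inE; have xi := xA i isT.
have cA : #|A i| = 1.
  by move/subsetP: (sF i) => /(_ (A i)); rewrite FA set11 inE k1 => /(_ isT) /andP[_ /eqP].
move/eqP/cards1P: cA xi => [a ->]; rewrite inE => /eqP <-.
rewrite k1 in cB; move/eqP/cards1P: cB => [b ->].
by rewrite inE (inj_eq set1_inj) eq_sym.
Qed.
End Main.

(** * The theorem *)

Local Open Scope ring_scope.

Lemma ksubsets_uniform n k : ksubsets n k = uniform_on setT k.
Proof. by apply/setP => A; rewrite !inE subsetT. Qed.

Lemma card_full_star n k (x : 'I_n) : (0 < k)%N -> #|full_star k x| = 'C(n.-1, k.-1).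
Proof.
move=> k0; rewrite /full_star ksubsets_uniform -card_link.
have -> : link x (uniform_on setT k) = uniform_on (setT :\ x) k.-1.
  apply/setP => A; rewrite !inE !subsetT subsetD1 subsetT /=.
  by case: (boolP (x \in A)) => //= xA; rewrite cardsU1 xA; case: (k) k0.
rewrite card_uniform_on; congr 'C(_, _).
by rewrite setTD cardsC1 card_ord.
Qed.

Lemma mu_star_size n k (F : {set {set 'I_n}}) : (0 < k <= n)%N ->
  #|F| = 'C(n.-1, k.-1) -> mu k F = k%:R / n%:R.
Proof.
move=> /andP[k0 kn] cF; rewrite /mu cF.
have C0 : 'C(n, k)%:R != 0 :> rat by rewrite pnatr_eq0 -lt0n bin_gt0.
have n0 : n%:R != 0 :> rat by rewrite pnatr_eq0 -lt0n (leq_trans k0).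
apply: (mulIf C0); rewrite divfK //; apply: (mulfI n0).
have := congr1 (fun a => a%:R : rat) (mul_bin_diag n k.-1).
by rewrite !natrM prednK // => ->; field.
Qed.

Lemma full_starE n k (F : {set {set 'I_n}}) x : F \subset ksubsets n k ->
  is_star F k x -> F = full_star k x.
Proof.
move=> /subsetP sF st; apply/setP => A; rewrite !inE.
case: eqP => [cA|cA] /=; first exact: st.
by apply/negP => /sF; rewrite inE => /eqP.
Qed.

(** Otherwise a choice of members would include the empty set at i and have empty intersection. Both
    products of the theorem then vanish. *)
Lemma cross_nonempty n r (k : 'I_r -> nat) (F : 'I_r -> {set {set 'I_n}}) :
  (forall i, F i \subset ksubsets n (k i)) -> cross_intersecting F ->
  (exists i, k i = 0%N) -> exists i, F i = set0.
Proof.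
move=> hF cr [i ki].
have [/forallP F0|] := boolP [forall j, F j != set0]; last first.
  by rewrite negb_forall => /existsP[j]; rewrite negbK => /eqP; exists j.
have [A FA] : exists A : 'I_r -> {set 'I_n}, forall j, A j \in F j.
  by apply: (@fin_all_exists _ _ (fun j X => X \in F j)) => j; have /set0Pn := F0 j.
have := cr A FA; have := subsetP (hF i) _ (FA i); rewrite inE ki cards_eq0 => /eqP Ai.
by rewrite (bigD1 i) //= Ai set0I eqxx.
Qed.

Lemma ord2E (hr : (2 <= 2)%N) (i : 'I_2) : i = idx1 hr \/ i = idx2 hr.
Proof. by case: i => [[|[|//]] Hi]; [left|right]; apply: val_inj. Qed.

Lemma cross_pair n (hr : (2 <= 2)%N) (F : 'I_2 -> {set {set 'I_n}}) : cross_intersecting F ->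
  forall A B, A \in F (idx1 hr) -> B \in F (idx2 hr) -> ~~ [disjoint A & B].
Proof.
move=> cr A B FA FB.
have := cr (fun i => if i == idx1 hr then A else B).
have e2 : (idx2 hr == idx1 hr) = false by [].
rewrite (bigD1 (idx1 hr)) //= (bigD1 (idx2 hr)) //= big_pred0; last first.
  by move=> i; case: (ord2E hr i) => ->.
rewrite setIT -setI_eq0.
by apply => i; case: (ord2E hr i) => ->; rewrite ?eqxx ?e2.
Qed.

Theorem theorem1p8 (n r : nat) (hn : (1 <= n)%N) (hr : (2 <= r)%N)
    (k : 'I_r -> nat)
    (hk : forall i : 'I_r, (k i)%:R <= (r%:R - 1) * n%:R / r%:R :> rat)
    (F : 'I_r -> {set {set 'I_n}})
    (hF : forall i : 'I_r, F i \subset ksubsets n (k i))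
    (hcross : cross_intersecting F) :
  [/\ \prod_(i < r) mu (k i) (F i) <= \prod_(i < r) ((k i)%:R / n%:R),
      (exists i : 'I_r, k i = 0%N) ->
        \prod_(i < r) mu (k i) (F i) = \prod_(i < r) ((k i)%:R / n%:R),
      (forall i : 'I_r, (0 < k i)%N) ->
      (3 <= r)%N \/ (r = 2%N /\ (k (idx1 hr) + k (idx2 hr) < n)%N) ->
        (\prod_(i < r) mu (k i) (F i) = \prod_(i < r) ((k i)%:R / n%:R)
         <-> exists x : 'I_n, forall i : 'I_r, F i = full_star (k i) x)
    & r = 2%N -> (k (idx1 hr) + k (idx2 hr) = n)%N ->
        [/\ (k (idx1 hr))%:R = n%:R / 2 :> rat,
            (k (idx2 hr))%:R = n%:R / 2 :> rat
          & (\prod_(i < r) mu (k i) (F i) = \prod_(i < r) ((k i)%:R / n%:R)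
             <-> exists G : {set {set 'I_n}},
                   [/\ G \subset ksubsets n n./2,
                       #|G|%:R = 'C(n, n./2)%:R / 2 :> rat,
                       F (idx1 hr) = G
                     & F (idx2 hr) = [set B in ksubsets n n./2 | ~: B \notin G]])]].
Proof.
have r0 : 0 < r%:R :> rat by rewrite ltr0n; apply: ltn_trans hr.
have n0 : 0 < n%:R :> rat by rewrite ltr0n.
have kr i : (r * k i <= r.-1 * n)%N.
  have rE : r.-1%:R = r%:R - 1 :> rat by rewrite pred_natr //; apply: ltn_trans hr.
  by have := hk i; rewrite ler_pdivlMr // -rE -!natrM ler_nat mulnC.
have kn i : (k i < n)%N.
  have lt : (r * k i < r * n)%N.
    by apply: leq_ltn_trans (kr i) _; rewrite ltn_mul2r ltn_predL hn ltnW.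
  by rewrite -(@ltn_pmul2l r) //; apply: ltn_trans hr.
have sF i : F i \subset uniform_on setT (k i) by rewrite -ksubsets_uniform.
have zero : (exists i, k i = 0%N) ->
    \prod_(i < r) mu (k i) (F i) = \prod_(i < r) ((k i)%:R / n%:R).
  move=> k0; have [j Fj] := cross_nonempty hF hcross k0; have [i ki] := k0.
  by rewrite (bigD1 j) //= /mu Fj cards0 !mul0r (bigD1 i) //= ki !mul0r.
have main : (forall i, (0 < k i)%N) ->
    \prod_(i < r) mu (k i) (F i) <= \prod_(i < r) ((k i)%:R / n%:R) /\
    (\prod_(i < r) mu (k i) (F i) = \prod_(i < r) ((k i)%:R / n%:R) ->
     forall i, #|F i| = 'C(n.-1, (k i).-1)).
  move=> k0.
  have P0 : 0 < \prod_(i < r) ((k i)%:R / n%:R) :> rat.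
    by apply: prodr_gt0 => i _; rewrite divr_gt0 // ltr0n.
  have [/forallP F0|] := boolP [forall j, F j != set0]; last first.
    rewrite negb_forall => /existsP[j]; rewrite negbK => /eqP Fj.
    have -> : \prod_(i < r) mu (k i) (F i) = 0 by rewrite (bigD1 j) //= /mu Fj cards0 !mul0r.
    by split; [apply: ltW|move=> e; move: P0; rewrite -e ltxx].
  have := @cross_product 'I_n 'I_r k F sF k0; rewrite !card_ord => H.
  exact: H kr hr hcross F0.
have sizeP : (forall i, (0 < k i)%N) -> (forall i, #|F i| = 'C(n.-1, (k i).-1)) ->
    \prod_(i < r) mu (k i) (F i) = \prod_(i < r) ((k i)%:R / n%:R).
  by move=> k0 cF; apply: eq_bigr => i _; apply: mu_star_size; rewrite ?k0 ?(ltnW (kn i)) ?cF.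
split.
- have [/forallP k0|] := boolP [forall i, 0 < k i]%N; first exact: (main k0).1.
  rewrite negb_forall => /existsP[i]; rewrite -eqn0Ngt => /eqP ki.
  by rewrite zero //; exists i.
- exact: zero.
- move=> k0 cond; split=> [e|[x Fx]]; last first.
    by apply: sizeP => // i; rewrite Fx card_full_star.
  have cF := (main k0).2 e.
  suff [x st] : exists x, forall i, is_star (F i) (k i) x.
    by exists x => i; apply: full_starE.
  case: cond => [r3|[r2 ltn]].
    have := @cross_star 'I_n 'I_r k F sF k0; rewrite !card_ord => H; exact: H kr hr hcross r3 cF.
  subst r.
  have := @pair_star 'I_n (F (idx1 hr)) (F (idx2 hr)) _ _ (k0 _) (k0 _).
  rewrite card_ord => /(_ _ _ ltn (sF _) (sF _) (cF _) (cF _) (cross_pair hcross)) [x [s1 s2]].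
  by exists x => i; case: (ord2E hr i) => ->.
move=> r2; subst r => kk.
(* For r = 2 the bound on k i reads 2 k i <= n, so a total of n forces equality. *)
have k2 i : (k i).*2 = n.
  have := kr (idx1 hr); have := kr (idx2 hr); rewrite /= mul1n.
  by case: (ord2E hr i) => ->; lia.
have kE i : k i = n./2 by rewrite -(k2 i) doubleK.
have k0 i : (0 < k i)%N by have := k2 i; lia.
have kR i : (k i)%:R = n%:R / 2 :> rat.
  by rewrite -(k2 i) -mul2n natrM mulrC mulKf.
(* A star is exactly half of the middle level. *)
have CE : 'C(n, n./2) = ('C(n.-1, n./2.-1)).*2.
  have := mul_bin_diag n (n./2.-1); rewrite prednK -?(kE (idx1 hr)) // => E.
  apply/eqP; rewrite -(eqn_pmul2l (k0 (idx1 hr))) -E -{1}(k2 (idx1 hr)).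
  by rewrite -!mul2n mulnCA mulnA.
have cof (H : {set {set 'I_n}}) : [set B in ksubsets n n./2 | ~: B \notin H] =
    ksubsets n n./2 :\: cofamily H.
  by apply/setP => B; rewrite !inE andbC.
have cofS (H : {set {set 'I_n}}) : H \subset ksubsets n n./2 ->
    cofamily H \subset ksubsets n n./2.
  rewrite ksubsets_uniform => /cofamily_uniform; rewrite card_ord.
  have -> // : (n - n./2 = n./2)%N by have := k2 (idx1 hr); rewrite kE; lia.
have cardU : #|ksubsets n n./2| = 'C(n, n./2).
  by rewrite ksubsets_uniform card_uniform_on cardsT card_ord.
have cardD (H : {set {set 'I_n}}) : H \subset ksubsets n n./2 ->
    (#|ksubsets n n./2 :\: cofamily H| = 'C(n, n./2) - #|H|)%N.
  by move=> sH; rewrite cardsD (setIidPr (cofS _ sH)) cardU card_cofamily.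
split=> //; split=> [e|[H [sH cH F1 F2]]].
  have cF i : #|F i| = 'C(n.-1, n./2.-1) by rewrite ((main k0).2 e) kE.
  have sF1 : F (idx1 hr) \subset ksubsets n n./2 by rewrite -(kE (idx1 hr)).
  exists (F (idx1 hr)); split=> //; first by rewrite cF CE -mul2n natrM mulrC mulKf.
  (* Cross-intersection gives only one inclusion; it is an equality because both families are half
     of the level. *)
  apply/eqP; rewrite cof eqEcard cardD // !cF CE -addnn addnK leqnn andbT.
  apply/subsetP => B FB; rewrite in_setD inE; apply/andP; split.
    apply/negP => FB'; have := cross_pair hcross FB' FB.
    by rewrite disjoint_sym disjoints_subset setCK subxx.
  by have := subsetP (hF (idx2 hr)) B FB; rewrite kE.
have cH2 : #|H| = 'C(n.-1, n./2.-1).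
  apply/eqP; rewrite -(eqr_nat rat) cH CE -mul2n natrM mulrC mulKf //.
apply: sizeP => // i; rewrite kE; case: (ord2E hr i) => ->; first by rewrite F1.
by rewrite F2 cof cardD // cH2 CE -addnn addnK.
Qed.
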